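(* The coarse moduli space $\mathsf{M}_{\mathrm{bin}}^5$ of binary quintics over $\mathbb{C}$ admits a non-trivial birational self-map, i.e. there exists a birational map $\mathsf{M}_{\mathrm{bin}}^5\dashrightarrow \mathsf{M}_{\mathrm{bin}}^5$ different from the identity.
   Context: The ground field is $\mathbb{C}$. Let $V(2,5)=\mathbb{C}[t_0,t_1]_5$ be the space of binary forms of degree $5$, and let $\mathbb{P}(V(2,5))$ be the space of nonzero forms up to scaling (equivalently, of effective divisors of degree $5$ on $\mathbb{P}^1$). The coarse moduli space $\mathsf{M}_{\mathrm{bin}}^5$ of binary quintics is the GIT-quotient $\mathbb{P}(V(2,5))/\!/\mathrm{PGL}(2)$, i.e. $\mathrm{Proj}$ of the graded algebra of $\mathrm{SL}(2)$-invariant polynomial functions on $V(2,5)$. *)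

(* Defs.v *)
From mathcomp Require Import all_boot all_order all_algebra.
From mathcomp Require Import fraction complex mpoly.
From mathcomp Require Import classical_sets reals.

Set Implicit Arguments.
Unset Strict Implicit.
Unset Printing Implicit Defensive.

Import GRing.Theory.

Local Open Scope classical_set_scope.
Local Open Scope ring_scope.

Section BinaryForms.
Variables (K : fieldType) (d : nat).

(* A matrix g acts on forms by f(t0, t1) |-> f(g (t0, t1)^T). This is a right
   action; replacing g by its inverse makes it a left action and does not change
   the SL(2)-invariants. *)
Definition form_act (g : 'M[K]_2) (f : {mpoly K[2]}) : {mpoly K[2]} :=
  f \mPo [tuple \sum_(j < 2) g i j *: 'X_j | i < 2].

(* Linear coordinates on K[t0, t1]_d: coordinate i is the coefficient of
   t0^(d - i) t1^i, without a binomial factor. *)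
Definition form_coord (f : {mpoly K[2]}) : 'I_d.+1 -> K :=
  fun i => f@_(U_(ord0) *+ (d - i) + U_(ord_max) *+ i)%MM.

(* The algebra of SL(2)-invariant polynomial functions on K[t0, t1]_d. It is
   graded by the degree of polynomials in the d + 1 coordinates. *)
Definition sl2_invariants : set {mpoly K[d.+1]} :=
  [set F | forall (g : 'M[K]_2) (f : {mpoly K[2]}),
     \det g = 1 -> f \is d.-homog ->
     F.@[form_coord (form_act g f)] = F.@[form_coord f]].

End BinaryForms.

(* The K-scheme Proj A, for A a graded K-subalgebra of a polynomial ring. As A is
   a domain, the homogeneous localization A_(P) is realized as the subring of
   fractions a / b (a, b homogeneous of the same degree, b not in P) of the
   fraction field of the polynomial ring. *)
Section Proj.
Variables (K : fieldType) (n : nat) (A : set {mpoly K[n]}).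

Notation S := {mpoly K[n]}.
Notation frac := {fraction {mpoly K[n]}}.

Definition graded_piece (d : nat) : set S := [set a | A a /\ a \is d.-homog].

Record is_proj_point (P : set S) : Prop := IsProjPoint {
  pt_sub : P `<=` A;
  pt_zero : P 0;
  pt_add : forall a b, P a -> P b -> P (a + b);
  pt_mul : forall a b, A a -> P b -> P (a * b);
  pt_prime : forall a b, A a -> A b -> P (a * b) -> P a \/ P b;
  pt_homog : forall a d, P a -> P (pihomog mdeg d a);
  pt_relevant : exists d a, [/\ (0 < d)%N, graded_piece d a & ~ P a]
}.

Definition proj : set (set S) := [set P | is_proj_point P].

(* Zariski topology: the open sets are the complements in Proj A of the closed
   sets V(I), for I a set of homogeneous elements of A. *)
Definition zariski_open (U : set (set S)) : Prop :=
  exists I : set S,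
    (forall a, I a -> exists d, graded_piece d a) /\
    U = [set P | proj P /\ ~ (I `<=` P)].

Definition zariski_dense (U : set (set S)) : Prop :=
  forall W, zariski_open W -> W !=set0 -> (U `&` W) !=set0.

Definition stalk (P : set S) : set frac :=
  [set x | exists d a b,
     [/\ graded_piece d a, graded_piece d b, ~ P b & x = tofrac a / tofrac b]].

Definition stalk_max (P : set S) : set frac :=
  [set x | exists d a b,
     [/\ graded_piece d a, graded_piece d b, P a, ~ P b
       & x = tofrac a / tofrac b]].

(* The structure sheaf: a section on U assigns to each P in U an element of the
   stalk at P, and is locally given by one fraction. Values outside U are
   irrelevant. *)
Definition is_section (U : set (set S)) (s : set S -> frac) : Prop :=
  forall P, U P ->
    exists W d a b,
      [/\ zariski_open W /\ W P, W `<=` U, graded_piece d a, graded_piece d b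
        & forall Q, W Q -> ~ Q b /\ s Q = tofrac a / tofrac b].

(* Data of a morphism of schemes from an open subscheme U to Proj A: the map on
   points and, at each P in U, the map stalk (f P) -> stalk P. A morphism of
   sheaves is the same as a family of maps on stalks sending sections to sections.
   Only the values at P in U and on stalk (f P) are meaningful. *)
Record premorphism := PreMorphism {
  on_points :> set S -> set S;
  on_stalk : set S -> frac -> frac
}.

(* f : U -> Proj A is a morphism of locally ringed spaces over K. *)
Record is_morphism (U : set (set S)) (f : premorphism) : Prop := IsMorphism {
  mor_points : forall P, U P -> proj (f P);
  mor_continuous : forall W, zariski_open W -> zariski_open (U `&` f @^-1` W);
  mor_stalk : forall P x, U P -> stalk (f P) x -> stalk P (on_stalk f P x);
  mor_add : forall P x y, U P -> stalk (f P) x -> stalk (f P) y ->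
    on_stalk f P (x + y) = on_stalk f P x + on_stalk f P y;
  mor_mul : forall P x y, U P -> stalk (f P) x -> stalk (f P) y ->
    on_stalk f P (x * y) = on_stalk f P x * on_stalk f P y;
  mor_const : forall P (c : K), U P ->
    on_stalk f P (tofrac c%:MP) = tofrac c%:MP;
  mor_local : forall P x, U P -> stalk_max (f P) x ->
    stalk_max P (on_stalk f P x);
  mor_section : forall W s, zariski_open W -> is_section W s ->
    is_section (U `&` f @^-1` W) (fun P => on_stalk f P (s (f P)))
}.

Definition eq_on (W : set (set S)) (f g : premorphism) : Prop :=
  forall P, W P -> f P = g P /\
    forall x, stalk (f P) x -> on_stalk f P x = on_stalk g P x.

Definition idm : premorphism := PreMorphism id (fun _ x => x).

Definition compm (g f : premorphism) : premorphism :=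
  PreMorphism (g \o f) (fun P x => on_stalk f P (on_stalk g (f P) x)).

(* Representatives (U, f) of rational maps Proj A --> Proj A. Proj A is reduced,
   irreducible and separated, so two of them define the same rational map iff they
   agree on a dense open subset of the common domain. *)
Definition rational_map (U : set (set S)) (f : premorphism) : Prop :=
  [/\ zariski_open U, zariski_dense U & is_morphism U f].

Definition rational_eq (U : set (set S)) (f : premorphism)
    (V : set (set S)) (g : premorphism) : Prop :=
  exists W, [/\ zariski_open W, zariski_dense W, W `<=` U `&` V & eq_on W f g].

(* For f a rational map with domain U and g one with domain V, g \o f has domain
   U `&` f @^-1` V, which has to be dense for g \o f to be a rational map; this
   follows from the rational equality. *)
Definition birational_map (U : set (set S)) (f : premorphism) : Prop :=
  rational_map U f /\
  exists V g, [/\ rational_map V g,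
    rational_eq (U `&` f @^-1` V) (compm g f) proj idm
    & rational_eq (V `&` g @^-1` U) (compm f g) proj idm].

End Proj.

(* The invariants of binary quintics over the complex numbers R[i]; the coarse
   moduli space of binary quintics is proj (quintic_invariants R). *)
Definition quintic_invariants (R : realType) : set {mpoly R[i][6]} :=
  @sl2_invariants R[i] 5.

Arguments quintic_invariants R : clear implicits.

(* Main.v *)
Require Import Defs.
From mathcomp Require Import all_boot all_order all_algebra.
From mathcomp Require Import fraction complex mpoly.
From mathcomp Require Import classical_sets reals.
From mathcomp Require Import perm boolp.
From mathcomp Require Import zify ring.

(** The algebra A of SL(2)-invariants of binary quintics contains invariants
    J4, J8, J12 of degrees 4, 8, 12, and after J12 is inverted its elements of
    degree divisible by 12 are polynomials in these three and the inverse of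
    J12.  The three invariants being algebraically independent, changing the
    sign of J8 is an automorphism of order two of the ring A_(J12), hence of the
    affine open subscheme J12 <> 0 of Proj A.  It moves the rational function
    J8^3 / J12^2 to its opposite, so it is not the identity.

    The invariants come from two covariant binary quadratics: tau = (f, f)_4, of
    degree 2 in the coefficients of the quintic f, and the Hessian h of the cubic
    canonizant, of degree 6.  Up to a constant J4 is the discriminant of tau, J12
    that of h, and J8 the polar pairing of tau and h.  Invariance need only be
    checked on the two unipotent one-parameter groups that generate SL(2).

    What makes A computable is Sylvester's canonical form [sylvester_form]: a
    quintic with J12 <> 0 is SL(2)-equivalent to a x^5 + b y^5 + c z^5 with
    x + y + z = 0.  Hence an invariant is determined by its values there
    [invariant_eq0], where it becomes a polynomial in a, b, c.  Permuting x, y, z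
    is, up to a scalar, in SL(2), so for a degree divisible by 12 this polynomial
    is symmetric, a weighted homogeneous polynomial in the elementary symmetric
    functions e1, e2, e3 of a, b, c.  On these quintics
      J4 = e2^2 - 4 e1 e3,    J8 = - e3^2 e2,    J12 = e3^4,
    so that e3^2 e2 and 4 e1 e3^5 = J8^2 - J4 J12 are polynomials in the basic
    invariants; multiplying by a power of J12 clears every other power of e3, all
    exponents being divisible by 4 [generation].  Solving the three equations for
    a, b, c shows that (J4, J8, J12) takes all values with J12 <> 0, which gives
    algebraic independence [theta_inj].

    The passage from a ring automorphism to a birational map of Proj
    [involution_birational] holds for any graded subalgebra A of a polynomial
    ring, any nonzero homogeneous s of positive degree and any involution psi of the field
    of degree zero fractions that preserves A_(s): a homogeneous prime P not
    containing s is sent to the prime whose trace on A_(s) is the inverse image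
    of the maximal ideal at P, and all stalk maps are restrictions of psi. *)

Set Implicit Arguments.
Unset Strict Implicit.
Unset Printing Implicit Defensive.

Import GRing.Theory Num.Theory.

Local Open Scope classical_set_scope.
Local Open Scope ring_scope.

(** * Graded subalgebras and stalks of Proj *)

Section GradedSubalgebra.
Variables (K : fieldType) (n : nat) (A : set {mpoly K[n]}).
Local Notation S := {mpoly K[n]}.
Local Notation "a %:F" := (tofrac a) (at level 1, format "a %:F").
Local Notation frac := {fraction {mpoly K[n]}}.

Record graded_subalgebra : Prop := GradedSubalgebra {
  gsa_const : forall c : K, A c%:MP;
  gsa_add : forall a b, A a -> A b -> A (a + b);
  gsa_mul : forall a b, A a -> A b -> A (a * b);
  gsa_pihomog : forall a d, A a -> A (pihomog mdeg d a)
}.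

Lemma pihomogM d N (a b : S) : (msize a <= N)%N -> (msize b <= N)%N ->
  pihomog mdeg d (a * b) =
  \sum_(p : 'I_N * 'I_N | (p.1 + p.2)%N == d)
    pihomog mdeg p.1 a * pihomog mdeg p.2 b.
Proof.
move=> sa sb.
rewrite [in LHS](pihomog_partitionE sa) [in LHS](pihomog_partitionE sb).
rewrite mulr_suml.
under eq_bigr do rewrite mulr_sumr.
rewrite pair_big /= raddf_sum /= [RHS]big_mkcond /=; apply: eq_bigr => -[i j] _ /=.
have hij := dhomogM (pihomogP mdeg i a) (pihomogP mdeg j b).
case: eqVneq => [<-|ne]; first by rewrite pihomog_dE.
exact: pihomog_ne0 hij.
Qed.

Hypothesis gA : graded_subalgebra.

Lemma gsa0 : A 0.
Proof. by rewrite -mpolyC0; apply: gsa_const. Qed.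

Lemma gsa_exp a m : A a -> A (a ^+ m).
Proof.
move=> Aa; elim: m => [|m IH]; first by rewrite expr0 -mpolyC1; apply: gsa_const.
by rewrite exprS; apply: gsa_mul.
Qed.

Lemma gsa_sum (I : Type) (r : seq I) (Q : pred I) (F : I -> S) :
  (forall i, Q i -> A (F i)) -> A (\sum_(i <- r | Q i) F i).
Proof.
move=> AF; elim/big_rec: _ => [|i x Qi Ax]; first exact: gsa0.
by apply: gsa_add => //; apply: AF.
Qed.

Lemma piece_pi d a : A a -> graded_piece A d (pihomog mdeg d a).
Proof. by move=> Aa; split; [apply: gsa_pihomog | apply: pihomogP]. Qed.

Lemma piece0 d : graded_piece A d 0.
Proof. by split; [apply: gsa0 | apply: dhomog0]. Qed.

Lemma piece_const c : graded_piece A 0 c%:MP.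
Proof.
split; first exact: gsa_const.
by rewrite -[c%:MP]mulr1 mul_mpolyC; apply: dhomogZ; apply: dhomog1.
Qed.

Lemma piece_add d a b :
  graded_piece A d a -> graded_piece A d b -> graded_piece A d (a + b).
Proof. by move=> [? ?] [? ?]; split; [apply: gsa_add | apply: dhomogD]. Qed.

Lemma piece_mul d e a b :
  graded_piece A d a -> graded_piece A e b -> graded_piece A (d + e) (a * b).
Proof. by move=> [? ?] [? ?]; split; [apply: gsa_mul | apply: dhomogM]. Qed.

Lemma piece_exp d a m : graded_piece A d a -> graded_piece A (d * m) (a ^+ m).
Proof. by move=> [? ?]; split; [apply: gsa_exp | apply: dhomogMn]. Qed.

(** The sets T d play the role of the homogeneous parts of a prime ideal, known
    only through homogeneous elements. *)
Section HomogeneousIdeal.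
Variable T : nat -> set S.
Hypothesis T0 : forall d, T d 0.
Hypothesis TD : forall d a b, T d a -> T d b -> T d (a + b).
Hypothesis TM : forall d e a b,
  graded_piece A d a -> T e b -> T (d + e) (a * b).
Hypothesis Tprime : forall d e a b, graded_piece A d a -> graded_piece A e b ->
  T (d + e) (a * b) -> T d a \/ T e b.

Definition homogeneous_hull : set S :=
  [set a | A a /\ forall d, T d (pihomog mdeg d a)].

Lemma T_sum d (I : Type) (r : seq I) (Q : pred I) (F : I -> S) :
  (forall i, Q i -> T d (F i)) -> T d (\sum_(i <- r | Q i) F i).
Proof.
move=> TF; elim/big_rec: _ => [|i x Qi Tx]; first exact: T0.
by apply: TD => //; apply: TF.
Qed.

Lemma hull0 : homogeneous_hull 0.
Proof. by split=> [|d]; [apply: gsa0 | rewrite pihomog0]. Qed.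

Lemma hullD a b : homogeneous_hull a -> homogeneous_hull b ->
  homogeneous_hull (a + b).
Proof.
move=> [Aa Ta] [Ab Tb]; split=> [|d]; first exact: gsa_add.
by rewrite pihomogD; apply: TD.
Qed.

Lemma hullM a b : A a -> homogeneous_hull b -> homogeneous_hull (a * b).
Proof.
move=> Aa [Ab Tb]; split=> [|d]; first exact: gsa_mul.
rewrite (pihomogM d (leq_maxl _ _) (leq_maxr _ _)).
apply: T_sum => -[i j] /= /eqP <-.
by apply: TM => //; apply: piece_pi.
Qed.

(** If neither factor lies in the hull, let i and j be the least degrees in which
    the factors have a component outside T. In the component of degree i + j of
    the product, all terms but the product of these two components lie in T, so
    primality on homogeneous elements is contradicted. *)
Lemma hull_prime a b : A a -> A b -> homogeneous_hull (a * b) ->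
  homogeneous_hull a \/ homogeneous_hull b.
Proof.
move=> Aa Ab [_ Tab].
have [|na] := pselect (homogeneous_hull a); first by left.
have [|nb] := pselect (homogeneous_hull b); first by right.
(* The least degree in which an element outside the hull has a component outside T. *)
have low c : A c -> ~ homogeneous_hull c -> exists d,
    ~ T d (pihomog mdeg d c) /\ forall e, (e < d)%N -> T e (pihomog mdeg e c).
  move=> Ac nc.
  have ex : exists d, `[< ~ T d (pihomog mdeg d c) >].
    apply: contra_notP nc => nex; split=> // d.
    by apply: contrapT => nT; apply: nex; exists d; apply/asboolP.
  exists (ex_minn ex); case: ex_minnP => d /asboolP nT mind; split=> // e ltde.
  apply: contrapT => nT'; have /mind : `[< ~ T e (pihomog mdeg e c) >] by apply/asboolP.
  by rewrite leqNgt ltde.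
have [i [ni lowi]] := low a Aa na.
have [j [nj lowj]] := low b Ab nb.
exfalso.
suff : T i (pihomog mdeg i a) \/ T j (pihomog mdeg j b) by case.
apply: Tprime; try exact: piece_pi.
pose N := maxn (maxn (msize a) (msize b)) (maxn i j).+1.
have sa : (msize a <= N)%N by rewrite /N !leq_max leqnn.
have sb : (msize b <= N)%N by rewrite /N !leq_max leqnn orbT.
have iN : (i < N)%N by rewrite /N leq_max !ltnS leq_maxl orbT.
have jN : (j < N)%N by rewrite /N leq_max !ltnS leq_maxr orbT.
have := Tab (i + j)%N; rewrite (pihomogM _ sa sb).
rewrite (bigD1 (Ordinal iN, Ordinal jN)) //=.
set X := pihomog mdeg i a * _; set Y := \sum_(p | _) _ => TXY.
have TY : T (i + j) Y.
  apply: T_sum => -[x y] /= /andP [/eqP xy ne].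
  have [ltx|] := ltnP x i.
    rewrite -xy addnC mulrC; apply: TM; [exact: piece_pi | exact: lowi].
  rewrite leq_eqVlt => /orP [/eqP ix|ltx].
    case/eqP: ne; congr pair; apply: val_inj => //=.
    by apply/eqP; rewrite -(eqn_add2l i) {1}ix xy.
  have lty : (y < j)%N.
    by rewrite -(ltn_add2l i) -xy ltn_add2r.
  by rewrite -xy; apply: TM; [exact: piece_pi | exact: lowj].
have -> : X = (X + Y) + (-1)%:MP * Y by rewrite mpolyCN mulN1r addrK.
by apply: TD => //; rewrite -[(i + j)%N]add0n; apply: TM => //; apply: piece_const.
Qed.

End HomogeneousIdeal.

(** This set is the function field of Proj A, inside that of the polynomial ring. *)
Definition frac0 : set frac :=
  [set x | exists d a b,
     [/\ graded_piece A d a, graded_piece A d b, b != 0 & x = a%:F / b%:F]].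

Section Stalk.
Variable P : set S.
Hypothesis pP : proj A P.

Lemma notin_neq0 b : ~ P b -> b != 0.
Proof. by move=> Pb; apply/eqP => b0; apply: Pb; rewrite b0; apply: (pt_zero pP). Qed.

Lemma notinM a b : A a -> A b -> ~ P a -> ~ P b -> ~ P (a * b).
Proof. by move=> Aa Ab nPa nPb /(pt_prime pP Aa Ab) []. Qed.

Lemma notinX a m : A a -> ~ P a -> ~ P (a ^+ m).
Proof.
move=> Aa nPa; elim: m => [|m IH].
  rewrite expr0 => P1; case: (pt_relevant pP) => d [b [_ [Ab _] nPb]]; apply: nPb.
  by rewrite -[b]mulr1; apply: (pt_mul pP).
by rewrite exprS; apply: notinM => //; apply: gsa_exp.
Qed.

Lemma inX a m : A a -> P (a ^+ m) -> P a.
Proof. by move=> Aa; apply: contraPP => nPa; apply: notinX. Qed.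

Lemma stalk_frac0 : stalk A P `<=` frac0.
Proof.
by move=> x [d [a [b [? ? ? ->]]]]; exists d, a, b; split=> //; apply: notin_neq0.
Qed.

(** Membership in the maximal ideal does not depend on the fraction chosen,
    because P is prime. *)
Lemma stalk_max_frac d a b : graded_piece A d a -> graded_piece A d b ->
  ~ P b -> stalk_max A P (a%:F / b%:F) -> P a.
Proof.
move=> ha hb nPb [e [c [f [hc hf Pc nPf /eqP]]]].
rewrite eqr_div ?tofrac_eq0 ?notin_neq0 // -!tofracM tofrac_eq => /eqP eq_af.
have : P (a * f) by rewrite eq_af mulrC; apply: (pt_mul pP) => //; case: hb.
by case/(pt_prime pP (proj1 ha) (proj1 hf)).
Qed.

Lemma stalkM x y : stalk A P x -> stalk A P y -> stalk A P (x * y).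
Proof.
move=> [d [a [b [ha hb nPb ->]]]] [e [c [f [hc hf nPf ->]]]].
exists (d + e)%N, (a * c), (b * f); split; try exact: piece_mul.
  by apply: notinM => //; [case: hb | case: hf].
by rewrite !tofracM mulf_div.
Qed.

Lemma stalk_maxM x y : stalk A P x -> stalk_max A P y -> stalk_max A P (x * y).
Proof.
move=> [d [a [b [ha hb nPb ->]]]] [e [c [f [hc hf Pc nPf ->]]]].
exists (d + e)%N, (a * c), (b * f); split; try exact: piece_mul.
- by apply: (pt_mul pP) => //; case: ha.
- by apply: notinM => //; [case: hb | case: hf].
- by rewrite !tofracM mulf_div.
Qed.

Lemma stalk_maxD x y :
  stalk_max A P x -> stalk_max A P y -> stalk_max A P (x + y).
Proof.
move=> [d [a [b [ha hb Pa nPb ->]]]] [e [c [f [hc hf Pc nPf ->]]]].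
exists (d + e)%N, (a * f + c * b), (b * f); split.
- by apply: piece_add; [apply: piece_mul | rewrite addnC; apply: piece_mul].
- exact: piece_mul.
- apply: (pt_add pP); rewrite mulrC; apply: (pt_mul pP) => //.
    by case: hf. by case: hb.
- by apply: notinM => //; [case: hb | case: hf].
- by rewrite addf_div ?tofrac_eq0 ?notin_neq0 // tofracD !tofracM.
Qed.

Lemma stalk_max_prime x y : stalk A P x -> stalk A P y ->
  stalk_max A P (x * y) -> stalk_max A P x \/ stalk_max A P y.
Proof.
move=> [d [a [b [ha hb nPb ->]]]] [e [c [f [hc hf nPf ->]]]].
rewrite mulf_div -!tofracM => m.
have Pac : P (a * c).
  apply: (stalk_max_frac (piece_mul ha hc) (piece_mul hb hf)) => //.
  by apply: notinM => //; [case: hb | case: hf].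
by case: (pt_prime pP (proj1 ha) (proj1 hc) Pac) => ?; [left | right];
  [exists d, a, b | exists e, c, f].
Qed.

Lemma stalkV x : stalk A P x -> ~ stalk_max A P x -> stalk A P x^-1.
Proof.
move=> [d [a [b [ha hb nPb ->]]]] nm; exists d, b, a; split=> //.
  by move=> Pa; apply: nm; exists d, a, b.
by rewrite invf_div.
Qed.

End Stalk.

(** * The birational map induced by an involution of a basic affine open *)

Section Involution.
Variables (k : nat) (s : S) (psi : frac -> frac).
Hypothesis k_gt0 : (0 < k)%N.
Hypothesis hs : graded_piece A k s.
Hypothesis s_neq0 : s != 0.

(** The coordinate ring A_(s) of the affine open subscheme where s does not vanish. *)
Definition loc : set frac :=
  [set x | exists m a, graded_piece A (k * m) a /\ x = a%:F / s%:F ^+ m].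

Hypothesis psiD : forall x y, frac0 x -> frac0 y -> psi (x + y) = psi x + psi y.
Hypothesis psiM : forall x y, frac0 x -> frac0 y -> psi (x * y) = psi x * psi y.
Hypothesis psiC : forall c : K, psi (c%:MP)%:F = (c%:MP)%:F.
Hypothesis psi_loc : forall x, loc x -> loc (psi x).
Hypothesis psiK : forall x, frac0 x -> psi (psi x) = x.

Definition basic_open : set (set S) := [set P | proj A P /\ ~ P s].

(** The homogeneous part of degree d of the image of P. An element a of degree d
    is tested through all its multiples a * c / s ^+ m of degree zero, rather than
    through a ^+ k / s ^+ d alone, so that closure under addition and
    multiplication is immediate. *)
Definition pull_piece (P : set S) (d : nat) : set S :=
  [set a | graded_piece A d a /\
     forall e c m, graded_piece A e c -> (d + e = k * m)%N ->
     stalk_max A P (psi ((a * c)%:F / s%:F ^+ m))].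

Definition pull (P : set S) : set S := homogeneous_hull (pull_piece P).

(** The stalk map does not depend on the point: every stalk is a subring of the
    function field, on which psi acts. *)
Definition involution_mor : premorphism K n := PreMorphism pull (fun _ => psi).

Lemma sF_neq0 m : s%:F ^+ m != 0.
Proof. by rewrite expf_neq0 // tofrac_eq0. Qed.

Lemma loc_frac0 x : loc x -> frac0 x.
Proof.
move=> [m [a [ha ->]]]; exists (k * m)%N, a, (s ^+ m); split=> //.
- exact: piece_exp.
- by rewrite expf_neq0.
- by rewrite tofracXn.
Qed.

Lemma locI m d e a b : graded_piece A d a -> graded_piece A e b ->
  (d + e = k * m)%N -> loc ((a * b)%:F / s%:F ^+ m).
Proof. by move=> ha hb dem; exists m, (a * b); rewrite -dem; split=> //; apply: piece_mul. Qed.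

Lemma pad_eq d : (d + d * k.-1 = k * d)%N.
Proof. by rewrite -mulnS prednK // mulnC. Qed.

(** The power a ^+ k, written so that its degree d + d * (k - 1) is visible. *)
Lemma padded d a : graded_piece A d a -> loc ((a * a ^+ k.-1)%:F / s%:F ^+ d).
Proof.
move=> ha; exact: (locI ha (piece_exp _ ha) (pad_eq d)).
Qed.

Lemma psi1 : psi 1 = 1.
Proof. by have := psiC 1; rewrite mpolyC1 tofrac1. Qed.

Lemma psi0 : psi 0 = 0.
Proof. by have := psiC 0; rewrite mpolyC0 tofrac0. Qed.

Lemma frac0V x : frac0 x -> frac0 x^-1.
Proof.
move=> [d [a [b [ha hb b0 ->]]]].
have [->|a0] := eqVneq a 0.
  rewrite tofrac0 mul0r invr0; exists d, 0, b; split=> //; first exact: piece0.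
  by rewrite tofrac0 mul0r.
by exists d, b, a; split=> //; rewrite invf_div.
Qed.

Lemma psi_neq0 x : frac0 x -> x != 0 -> psi x != 0.
Proof.
move=> fx x0; apply/eqP => px; have := psiM fx (frac0V fx).
by rewrite divff // psi1 px mul0r => /eqP; rewrite oner_eq0.
Qed.

Lemma psiV x : frac0 x -> psi x^-1 = (psi x)^-1.
Proof.
move=> fx; have [->|x0] := eqVneq x 0; first by rewrite invr0 psi0 invr0.
have := psiM fx (frac0V fx); rewrite divff // psi1 => e.
by rewrite -[RHS]mulr1 e (mulKf (psi_neq0 fx x0)).
Qed.

Section AtPoint.
Variable P : set S.
Hypothesis pP : proj A P.
Hypothesis nPs : ~ P s.

Lemma power_notin m : ~ P (s ^+ m).
Proof. by apply: (notinX pP) => //; case: hs. Qed.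

Lemma loc_stalk x : loc x -> stalk A P x.
Proof.
move=> [m [a [ha ->]]]; exists (k * m)%N, a, (s ^+ m); split=> //.
- exact: piece_exp.
- exact: power_notin.
- by rewrite tofracXn.
Qed.

Lemma loc_max m a : graded_piece A (k * m) a ->
  stalk_max A P (a%:F / s%:F ^+ m) <-> P a.
Proof.
move=> ha; rewrite -tofracXn; split=> [|Pa].
  by apply: (stalk_max_frac pP ha (piece_exp m hs)); apply: power_notin.
exists (k * m)%N, a, (s ^+ m); split=> //; [exact: piece_exp | exact: power_notin].
Qed.

Lemma stalk_max0 : stalk_max A P 0.
Proof.
exists 0%N, 0, 1; split.
- exact: piece0.
- by rewrite -mpolyC1; apply: piece_const.
- exact: (pt_zero pP).
- by have := @power_notin 0; rewrite expr0.
- by rewrite tofrac0 mul0r.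
Qed.

Lemma pull0 d : pull_piece P d 0.
Proof.
split=> [|e c m _ _]; first exact: piece0.
by rewrite mul0r tofrac0 mul0r psi0; apply: stalk_max0.
Qed.

Lemma pullD d a b : pull_piece P d a -> pull_piece P d b ->
  pull_piece P d (a + b).
Proof.
move=> [ha Ta] [hb Tb]; split=> [|e c m hc dem]; first exact: piece_add.
rewrite mulrDl tofracD mulrDl psiD; last 2 first.
- exact: loc_frac0 (locI ha hc dem).
- exact: loc_frac0 (locI hb hc dem).
by apply: stalk_maxD => //; [apply: Ta hc dem | apply: Tb hc dem].
Qed.

Lemma pullM d e a b : graded_piece A d a -> pull_piece P e b ->
  pull_piece P (d + e) (a * b).
Proof.
move=> ha [hb Tb]; split=> [|f c m hc dm]; first exact: piece_mul.
rewrite [a * b]mulrC -mulrA; apply: (Tb (d + f)%N); first exact: piece_mul.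
by rewrite -dm addnA [(e + d)%N]addnC.
Qed.

Lemma pull_prime d e a b : graded_piece A d a -> graded_piece A e b ->
  pull_piece P (d + e) (a * b) -> pull_piece P d a \/ pull_piece P e b.
Proof.
move=> ha hb [_ Tab].
have [|na] := pselect (pull_piece P d a); first by left.
right; split=> // f c m hc efm; apply: contrapT => nb.
apply: na; split=> // g h p hh dgp.
have fa := locI ha hh dgp; have fb := locI hb hc efm.
have [] // := stalk_max_prime pP (loc_stalk (psi_loc fa)) (loc_stalk (psi_loc fb)).
rewrite -psiM; try exact: loc_frac0.
rewrite mulf_div -tofracM -exprD mulrACA; apply: (Tab (g + f)%N).
  exact: piece_mul.
by rewrite addnACA dgp efm mulnDr.
Qed.

Lemma pullE d a : graded_piece A d a -> pull P a <-> pull_piece P d a.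
Proof.
move=> [Aa ha]; split=> [[_ /(_ d)]|Ta]; first by rewrite pihomog_dE.
split=> // e; have [<-|ne] := eqVneq d e; first by rewrite pihomog_dE.
by rewrite (pihomog_ne0 ne ha); apply: pull0.
Qed.

Lemma pull_loc m a : graded_piece A (k * m) a ->
  pull P a <-> stalk_max A P (psi (a%:F / s%:F ^+ m)).
Proof.
move=> ha; split=> [/(pullE ha) [_]|Ma].
  move=> /(_ 0%N 1 m); rewrite mulr1; apply; last by rewrite addn0.
  by rewrite -mpolyC1; apply: piece_const.
apply/(pullE ha); split=> // e c p hc mep.
have mp : (m <= p)%N by rewrite -(leq_pmul2l k_gt0) -mep leq_addr.
have fa : loc (a%:F / s%:F ^+ m) by exists m, a.
have fc : loc (c%:F / s%:F ^+ (p - m)).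
  by exists (p - m)%N, c; rewrite mulnBr -mep addKn.
rewrite tofracM -(subnKC mp) exprD -mulf_div psiM; try exact: loc_frac0.
by rewrite mulrC; apply: stalk_maxM => //; apply: loc_stalk; apply: psi_loc.
Qed.

Lemma pull_notin_s : ~ pull P s.
Proof.
have hs1 : graded_piece A (k * 1) s by rewrite muln1.
move/(pull_loc hs1); rewrite expr1 divff ?tofrac_eq0 // psi1 => m1.
have := @power_notin 0; rewrite expr0; apply.
have h1 : graded_piece A (k * 0) 1 by rewrite muln0 -mpolyC1; apply: piece_const.
by apply/(loc_max h1); rewrite expr0 tofrac1 divr1.
Qed.

Lemma pull_point : basic_open (pull P).
Proof.
split; last exact: pull_notin_s.
split.
- by move=> a [].
- exact: (hull0 pull0).
- exact: (hullD pullD).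
- exact: (hullM pull0 pullD pullM).
- exact: (hull_prime pull0 pullD pullM pull_prime).
- by move=> a d [Aa Ta]; apply/(pullE (piece_pi d Aa)); apply: Ta.
- by exists k, s; split=> //; apply: pull_notin_s.
Qed.

(** In arbitrary degree a single multiple suffices: the power a ^+ k, since the
    image of P is prime. *)
Lemma pull_pad d a : graded_piece A d a ->
  pull P a <-> stalk_max A P (psi ((a * a ^+ k.-1)%:F / s%:F ^+ d)).
Proof.
move=> ha; split=> [/(pullE ha) [_ Ta]|Ma].
  by apply: (Ta (d * k.-1)%N); [apply: piece_exp | apply: pad_eq].
have hp : graded_piece A (k * d) (a * a ^+ k.-1).
  by rewrite -pad_eq; apply: piece_mul => //; apply: piece_exp.
have /(inX pull_point.1) : pull P (a ^+ k).
  by rewrite -(prednK k_gt0) exprS; apply/(pull_loc hp).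
by apply; case: ha.
Qed.

(** On A_(s) the map on points is the inverse image under psi; in this form it can
    be iterated. *)
Lemma pull_max x : loc x -> stalk_max A (pull P) x <-> stalk_max A P (psi x).
Proof.
have [pQ nQs] := pull_point; move=> [m [a [ha ->]]].
rewrite -pull_loc // -tofracXn; split=> [|Qa].
  by apply: (stalk_max_frac pQ ha (piece_exp m hs)); apply: notinX; case: hs.
exists (k * m)%N, a, (s ^+ m); split=> //; first exact: piece_exp.
by apply: notinX; case: hs.
Qed.

End AtPoint.

(** Elements of degree zero can be rewritten over a common power of s, with a
    denominator that vanishes only where the original one does. *)
Lemma frac_loc d a b : graded_piece A d a -> graded_piece A d b -> b != 0 ->
  a%:F / b%:F = (a * b ^+ k.-1)%:F / s%:F ^+ d / ((b * b ^+ k.-1)%:F / s%:F ^+ d).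
Proof.
move=> ha hb b0.
rewrite invf_div mulrA divfK ?sF_neq0 // !tofracM -mulf_div divff ?mulr1 //.
by rewrite tofrac_eq0 expf_neq0.
Qed.

(** Points are homogeneous ideals, so they are determined by their homogeneous elements. *)
Lemma proj_homog Q a : proj A Q -> Q a <-> A a /\ forall d, Q (pihomog mdeg d a).
Proof.
move=> pQ; split=> [Qa|[Aa Qa]].
  by split=> [|d]; [apply: (pt_sub pQ) | apply: (pt_homog pQ)].
rewrite [a](pihomog_partitionE (leqnn (msize a))).
elim/big_rec: _ => [|i x _ Qx]; first exact: (pt_zero pQ).
exact: (pt_add pQ).
Qed.

(** Homogeneous primes not containing s are determined by their trace on A_(s),
    where applying psi twice is the identity. *)
Lemma pull_involutive P : basic_open P -> pull (pull P) = P.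
Proof.
move=> [pP nPs]; have [pQ nQs] := pull_point pP nPs.
have [pR _] := pull_point pQ nQs.
have hom d a : graded_piece A d a -> pull (pull P) a <-> P a.
  move=> ha; have la := padded ha.
  rewrite (pull_pad pQ nQs ha) (pull_max pP nPs (psi_loc la)) psiK; last exact: loc_frac0.
  rewrite loc_max //; last by rewrite -pad_eq; apply: piece_mul => //; apply: piece_exp.
  rewrite -exprS prednK //; split=> [/(inX pP)|Pa]; first by apply; case: ha.
  rewrite -(prednK k_gt0) exprSr; apply: (pt_mul pP) => //.
  by apply: gsa_exp; case: ha.
apply/seteqP; split=> a; rewrite /= (proj_homog _ pR) (proj_homog _ pP).
  by move=> [Aa h]; split=> // d; apply/(hom _ _ (piece_pi d Aa)).
by move=> [Aa h]; split=> // d; apply/(hom _ _ (piece_pi d Aa)).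
Qed.

Lemma basic_open_open : zariski_open A basic_open.
Proof.
exists [set s]; split=> [a ->|]; first by exists k.
apply/seteqP; split=> P [pP nP]; split=> //.
  by move=> sP; apply: nP; apply: sP.
by move=> Ps; apply: nP => a ->.
Qed.

(** The zero ideal is the generic point: it lies in every nonempty open set. *)
Lemma generic_point : proj A [set 0] /\
  forall W, zariski_open A W -> W !=set0 -> W [set 0].
Proof.
have p0 : proj A [set 0].
  split.
  - by move=> a ->; apply: gsa0.
  - by [].
  - by move=> a b -> ->; rewrite addr0.
  - by move=> a b _ ->; rewrite mulr0.
  - by move=> a b _ _ /eqP; rewrite mulf_eq0 => /orP [] /eqP ->; [left | right].
  - by move=> a d ->; rewrite pihomog0.
  - by exists k, s; split=> //; apply/eqP.
split=> // W [I [hI ->]] [P [pP nIP]]; split=> //.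
apply: contra_not nIP => I0 a /I0 ->; exact: (pt_zero pP).
Qed.

Lemma basic_open_dense : zariski_dense A basic_open.
Proof.
move=> W oW W0; have [p0 gen] := generic_point.
by exists [set 0]; split; [split=> //; apply/eqP | apply: gen].
Qed.

(** On the stalk at the image point, psi is computed on fractions whose
    denominators psi sends to units at P. *)
Lemma psi_frac P d a b : basic_open P -> graded_piece A d a ->
  graded_piece A d b -> ~ pull P b ->
  exists x y, [/\ loc x, loc y, ~ stalk_max A P (psi y),
    stalk_max A (pull P) (a%:F / b%:F) -> stalk_max A P (psi x)
    & psi (a%:F / b%:F) = psi x / psi y].
Proof.
move=> [pP nPs] ha hb nQb; have [pQ nQs] := pull_point pP nPs.
have hbk := piece_exp k.-1 hb.
have lx := locI ha hbk (pad_eq d); have ly := padded hb.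
exists ((a * b ^+ k.-1)%:F / s%:F ^+ d), ((b * b ^+ k.-1)%:F / s%:F ^+ d).
split=> //.
- by rewrite -pull_pad.
- move=> Mab; apply/(pull_max pP nPs lx).
  have Qa : pull P a := stalk_max_frac pQ ha hb nQb Mab.
  have hab : graded_piece A (k * d) (a * b ^+ k.-1).
    by rewrite -pad_eq; apply: piece_mul.
  apply/(loc_max pQ nQs hab); rewrite mulrC; apply: (pt_mul pQ) => //.
  by case: hbk.
rewrite (frac_loc ha hb (notin_neq0 pQ nQb)).
rewrite psiM ?psiV //; try exact: loc_frac0.
by apply: frac0V; apply: loc_frac0.
Qed.

(** If psi sends a ^+ k / s ^+ d to b / s ^+ m, then a vanishes at the image of P
    exactly when b vanishes at P; the extra factor s in the equations b * s
    removes the points outside the basic open set. *)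
Lemma pull_open W : zariski_open A W ->
  zariski_open A (basic_open `&` pull @^-1` W).
Proof.
move=> [I [hI ->]].
exists [set c | exists a d m b, [/\ I a, graded_piece A d a,
  graded_piece A (k * m) b, psi ((a * a ^+ k.-1)%:F / s%:F ^+ d) = b%:F / s%:F ^+ m
  & c = b * s]].
split=> [c [a [d [m [b [_ _ hb _ ->]]]]]|].
  by exists (k * m + k)%N; apply: piece_mul.
apply/seteqP; split=> P.
  move=> [[pP nPs] [pQ nIQ]]; split=> // sub; apply: nIQ => a Ia.
  have [d ha] := hI a Ia.
  have [m [b [hb eq_b]]] := psi_loc (padded ha).
  apply/(pull_pad pP nPs ha); rewrite eq_b; apply/(loc_max pP nPs hb).
  have /(pt_prime pP (proj1 hb) (proj1 hs)) [] // : P (b * s).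
  by apply: sub; exists a, d, m, b.
move=> [pP nsub].
have nPs : ~ P s.
  move=> Ps; apply: nsub => c [a [d [m [b [_ _ hb _ ->]]]]].
  by apply: (pt_mul pP) => //; case: hb.
split=> //; split; first by case: (pull_point pP nPs).
apply: contra_not nsub => IQ c [a [d [m [b [Ia ha hb eq_b ->]]]]].
rewrite mulrC; apply: (pt_mul pP); first by case: hs.
by apply/(loc_max pP nPs hb); rewrite -eq_b; apply/(pull_pad pP nPs ha)/IQ.
Qed.

(** A local expression a / b is first rewritten with numerator and denominator in
    A_(s), to which psi can be applied separately. *)
Lemma pull_section W t : zariski_open A W -> is_section A W t ->
  is_section A (basic_open `&` pull @^-1` W) (fun P => psi (t (pull P))).
Proof.
move=> oW st P [UP WQ].
have [W' [d [a [b [[oW' W'Q] W'W ha hb eq_t]]]]] := st _ WQ.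
have [m [x [hx eq_x]]] := psi_loc (locI ha (piece_exp k.-1 hb) (pad_eq d)).
have [p [y [hy eq_y]]] := psi_loc (padded hb).
have hsm i := piece_exp i hs.
exists (basic_open `&` pull @^-1` W'), (k * m + k * p)%N, (x * s ^+ p), (y * s ^+ m).
split.
- by split; first exact: pull_open.
- by move=> Q [UQ W'Q']; split=> //; apply: W'W.
- exact: piece_mul.
- by rewrite addnC; apply: piece_mul.
move=> Q [[pQ nQs] W'Q']; have [nb ->] := eq_t _ W'Q'.
have b0 : b != 0 by apply: (notin_neq0 (pull_point pQ nQs).1).
split.
  apply: (notinM pQ); [by case: hy | by case: (hsm m) | | exact: power_notin].
  by move=> /(loc_max pQ nQs hy); rewrite -eq_y -pull_pad.
rewrite (frac_loc ha hb b0).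
have fx := loc_frac0 (locI ha (piece_exp k.-1 hb) (pad_eq d)).
have fy := loc_frac0 (padded hb).
rewrite (psiM fx (frac0V fy)) (psiV fy) eq_x eq_y.
by rewrite !tofracM !tofracXn invf_div mulf_div [_ * y%:F]mulrC.
Qed.

Lemma involution_morphism : is_morphism A basic_open involution_mor.
Proof.
split.
- by move=> P [pP nPs]; case: (pull_point pP nPs).
- exact: pull_open.
- move=> P x UP [d [a [b [ha hb nQb ->]]]] /=.
  have [u [v [lu lv nv _ ->]]] := psi_frac UP ha hb nQb.
  case: UP => pP nPs; apply: (stalkM pP); first exact: loc_stalk (psi_loc lu).
  by apply: stalkV => //; apply: loc_stalk => //; apply: psi_loc.
- move=> P x y [pP nPs] hx hy /=; have [pQ _] := pull_point pP nPs.
  by apply: psiD; apply: (stalk_frac0 pQ).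
- move=> P x y [pP nPs] hx hy /=; have [pQ _] := pull_point pP nPs.
  by apply: psiM; apply: (stalk_frac0 pQ).
- by move=> P c _; apply: psiC.
- move=> P x UP Mx /=; move: (Mx) => [d [a [b [ha hb Qa nQb eq_x]]]].
  move: Mx; rewrite eq_x.
  have [u [v [lu lv nv Mu ->]]] := psi_frac UP ha hb nQb => /Mu {}Mu.
  case: UP => pP nPs; rewrite mulrC; apply: (stalk_maxM pP) => //.
  by apply: stalkV => //; apply: loc_stalk => //; apply: psi_loc.
- exact: pull_section.
Qed.

(** The rational map is its own inverse, on the whole basic open set. *)
Theorem involution_birational : birational_map A basic_open involution_mor.
Proof.
have oU := basic_open_open; have dU := basic_open_dense.
have mf := involution_morphism.
have rU : rational_map A basic_open involution_mor by split.
have eqU : rational_eq A (basic_open `&` involution_mor @^-1` basic_open)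
    (compm involution_mor involution_mor) (proj A) (idm K n).
  exists basic_open; split=> //.
    by move=> P [pP nPs]; split=> //; split=> //; apply: pull_point.
  move=> P UP; split; first exact: pull_involutive.
  move=> x /=; rewrite pull_involutive //; case: UP => pP _ hx.
  by apply: psiK; apply: (stalk_frac0 pP).
by split=> //; exists basic_open, involution_mor; split.
Qed.

End Involution.
End GradedSubalgebra.

(** * Polynomials vanishing at all points *)

Section VanishingPolynomials.

Lemma muni_coef (R : nzRingType) n (p : {mpoly R[n.+1]}) d m :
  ((muni p)`_d)@_m = p@_[multinom of rcons m d].
Proof.
elim/mpolyind: p => [|c m' p _ _ IH]; first by rewrite muni0 coef0 !mcoeff0.
rewrite muniD muniZ coefD coefZ [LHS]mcoeffD mcoeffCM [RHS]mcoeffD mcoeffZ.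
congr (_ * _ + _); last exact: IH.
rewrite muniE msuppX big_seq1 mcoeffX eqxx scale1r coefZ coefXn mcoeffX.
set m1 := [multinom _ | _ < _].
have -> : (m' == [multinom of rcons m d]) = (m1 == m) && (d == m' ord_max).
  apply/eqP/andP => [e|[/eqP <- /eqP ->]].
    split; last by rewrite e (mnm_nth 0) /= nth_rcons size_tuple ltnn eqxx.
    apply/eqP/mnmP => i; rewrite mnmE e !(mnm_nth 0) /= nth_rcons size_tuple ltn_ord.
    by [].
  apply/mnmP => i; rewrite [RHS](mnm_nth 0) /= nth_rcons size_tuple ?card_ord.
  have [lti|gei] := ltnP i n; last first.
    have ei : nat_of_ord i = n by apply/eqP; rewrite eqn_leq gei -ltnS ltn_ord.
    by rewrite ei eqxx; congr (m' _); apply: val_inj.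
  have -> : i = widen_ord (leqnSn n) (Ordinal lti) by apply: val_inj.
  by rewrite -(mnm_nth 0 m1) mnmE.
by case: (d == _); rewrite ?andbT ?andbF ?mulr1 ?mulr0 ?mcoeff0 ?mcoeffX.
Qed.

Definition meval_rcons (R : comNzRingType) n (v : 'I_n -> R) (x : R) : 'I_n.+1 -> R :=
  fun i => if unlift ord_max i is Some j then v j else x.

Lemma muni_horner (R : comNzRingType) n (p : {mpoly R[n.+1]}) (v : 'I_n -> R) x :
  (map_poly (meval v) (muni p)).[x] = p.@[meval_rcons v x].
Proof.
elim/mpolyind: p => [|c m p _ _ IH]; first by rewrite muni0 map_poly0 horner0 meval0.
rewrite muniD muniZ rmorphD /= map_polyZ hornerD hornerZ /= mevalC [RHS]mevalD mevalZ.
congr (_ * _ + _); last exact: IH.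
rewrite muniE msuppX big_seq1 mcoeffX eqxx scale1r.
rewrite map_polyZ map_polyXn hornerZ hornerXn !mevalX big_ord_recr /=.
rewrite /meval_rcons unlift_none; congr (_ * _). rewrite mevalX; apply: eq_bigr => i _.
rewrite mnmE; have -> : widen_ord (leqnSn n) i = lift ord_max i.
  by apply: val_inj; rewrite /= /bump leqNgt ltn_ord.
by rewrite liftK.
Qed.

Lemma poly_eq0_char0 (F : numDomainType) (p : {poly F}) :
  (forall x, p.[x] = 0) -> p = 0.
Proof.
move=> p0; apply/eqP; apply: contraT => pn0.
have := @max_poly_roots _ p [seq i%:R | i <- iota 0 (size p)] pn0.
rewrite size_map size_iota ltnn; apply.
  by apply/allP => _ /mapP [i _ ->]; apply/rootP.
by rewrite map_inj_uniq ?iota_uniq // => i j /eqP; rewrite eqr_nat => /eqP.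
Qed.

(** Induction on the number of variables: for fixed values of the first n
    variables the polynomial in the last one has infinitely many roots, so its
    coefficients vanish at all points. *)
Lemma mpoly_eq0_char0 (F : numDomainType) n (p : {mpoly F[n]}) :
  (forall v, p.@[v] = 0) -> p = 0.
Proof.
elim: n p => [|n IH] p p0.
  have := p0 (fun=> 0); rewrite [p]nvar0_mpolyC mevalC => ->.
  by rewrite mpolyC0.
apply/mpolyP => m; rewrite mcoeff0.
have vm : m = [multinom of rcons [multinom m (widen_ord (leqnSn n) i) | i < n] (m ord_max)].
  apply/mnmP => i; rewrite [RHS](mnm_nth 0) /= nth_rcons size_map size_enum_ord.
  have [lti|gei] := ltnP i n.
    rewrite (nth_map (Ordinal lti)) ?size_enum_ord //; congr (m _); apply: val_inj.
    by rewrite /= nth_enum_ord.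
  have ei : nat_of_ord i = n by apply/eqP; rewrite eqn_leq gei -ltnS ltn_ord.
  by rewrite ei eqxx; congr (m _); apply: val_inj.
rewrite vm -muni_coef [X in mcoeff _ X]IH ?mcoeff0 // => v.
have /polyP /(_ (m ord_max)) : map_poly (meval v) (muni p) = 0.
  by apply: poly_eq0_char0 => x; rewrite muni_horner.
by rewrite coef_map coef0.
Qed.

End VanishingPolynomials.

(** * Explicit invariants of binary quintics *)

(** A quintic is given by its normalized coefficients b_i, with
    f = sum of binomial(5, i) b_i x^(5-i) y^i, and a quadratic or a cubic by its plain
    coefficients. *)
Section InvariantFormulas.
Variable T : comNzRingType.

Definition disc2 (p : T * T * T) : T := let: (p0, p1, p2) := p in p1 ^+ 2 - 4 * p0 * p2.

(** The opposite of the bilinear form polarizing [disc2]: polar2 p p = - disc2 p. *)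
Definition polar2 (p q : T * T * T) : T :=
  let: (p0, p1, p2) := p in let: (q0, q1, q2) := q in
  2 * p0 * q2 - p1 * q1 + 2 * p2 * q0.

Definition hessian3 (c : T * T * T * T) : T * T * T :=
  let: (c0, c1, c2, c3) := c in
  (c1 ^+ 2 - 3 * c0 * c2, c1 * c2 - 9 * c0 * c3, c2 ^+ 2 - 3 * c1 * c3).

(** The quadratic covariant of degree two, the transvectant (f, f)_4 up to a constant. *)
Definition tau (b : seq T) : T * T * T :=
  (b`_0 * b`_4 - 4 * b`_1 * b`_3 + 3 * b`_2 ^+ 2,
   b`_0 * b`_5 - 3 * b`_1 * b`_4 + 2 * b`_2 * b`_3,
   b`_1 * b`_5 - 4 * b`_2 * b`_4 + 3 * b`_3 ^+ 2).

(** The cubic covariant of degree three: its coefficients are the maximal minors of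
    the Hankel matrix with rows (b_i, b_(i+1), b_(i+2), b_(i+3)), i = 0, 1, 2. It is
    proportional to x y z on Sylvester's canonical forms. *)
Definition canonizant (b : seq T) : T * T * T * T :=
  (b`_0 * (b`_2 * b`_4 - b`_3 ^+ 2) - b`_1 * (b`_1 * b`_4 - b`_2 * b`_3)
     + b`_2 * (b`_1 * b`_3 - b`_2 ^+ 2),
   b`_0 * (b`_2 * b`_5 - b`_3 * b`_4) - b`_1 * (b`_1 * b`_5 - b`_2 * b`_4)
     + b`_3 * (b`_1 * b`_3 - b`_2 ^+ 2),
   b`_0 * (b`_3 * b`_5 - b`_4 ^+ 2) - b`_2 * (b`_1 * b`_5 - b`_2 * b`_4)
     + b`_3 * (b`_1 * b`_4 - b`_2 * b`_3),
   b`_1 * (b`_3 * b`_5 - b`_4 ^+ 2) - b`_2 * (b`_2 * b`_5 - b`_3 * b`_4)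
     + b`_3 * (b`_2 * b`_4 - b`_3 ^+ 2)).

Definition I4 b := disc2 (tau b).
Definition I8 b := polar2 (tau b) (hessian3 (canonizant b)).
Definition I12 b := disc2 (hessian3 (canonizant b)).

(** The substitutions x -> x + t y and y -> y + t x on the coefficients of forms of
    degree 2, 3 and 5. *)
Definition upper2 (t : T) (p : T * T * T) : T * T * T :=
  let: (p0, p1, p2) := p in (p0, p1 + 2 * t * p0, p2 + t * p1 + t ^+ 2 * p0).
Definition lower2 (t : T) (p : T * T * T) : T * T * T :=
  let: (p0, p1, p2) := p in (p0 + t * p1 + t ^+ 2 * p2, p1 + 2 * t * p2, p2).

Definition upper3 (t : T) (c : T * T * T * T) : T * T * T * T :=
  let: (c0, c1, c2, c3) := c in
  (c0, c1 + 3 * t * c0, c2 + 2 * t * c1 + 3 * t ^+ 2 * c0,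
   c3 + t * c2 + t ^+ 2 * c1 + t ^+ 3 * c0).
Definition lower3 (t : T) (c : T * T * T * T) : T * T * T * T :=
  let: (c0, c1, c2, c3) := c in
  (c0 + t * c1 + t ^+ 2 * c2 + t ^+ 3 * c3, c1 + 2 * t * c2 + 3 * t ^+ 2 * c3,
   c2 + 3 * t * c3, c3).

Definition upper5 (t : T) (b : seq T) : seq T :=
  [:: b`_0; b`_1 + t * b`_0; b`_2 + 2 * t * b`_1 + t ^+ 2 * b`_0;
      b`_3 + 3 * t * b`_2 + 3 * t ^+ 2 * b`_1 + t ^+ 3 * b`_0;
      b`_4 + 4 * t * b`_3 + 6 * t ^+ 2 * b`_2 + 4 * t ^+ 3 * b`_1 + t ^+ 4 * b`_0;
      b`_5 + 5 * t * b`_4 + 10 * t ^+ 2 * b`_3 + 10 * t ^+ 3 * b`_2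
        + 5 * t ^+ 4 * b`_1 + t ^+ 5 * b`_0].
Definition lower5 (t : T) (b : seq T) : seq T :=
  [:: b`_0 + 5 * t * b`_1 + 10 * t ^+ 2 * b`_2 + 10 * t ^+ 3 * b`_3
        + 5 * t ^+ 4 * b`_4 + t ^+ 5 * b`_5;
      b`_1 + 4 * t * b`_2 + 6 * t ^+ 2 * b`_3 + 4 * t ^+ 3 * b`_4 + t ^+ 4 * b`_5;
      b`_2 + 3 * t * b`_3 + 3 * t ^+ 2 * b`_4 + t ^+ 3 * b`_5;
      b`_3 + 2 * t * b`_4 + t ^+ 2 * b`_5; b`_4 + t * b`_5; b`_5].

Lemma tau_upper t b : tau (upper5 t b) = upper2 t (tau b).
Proof. by rewrite /tau /upper5 /upper2 /=; congr (_, _, _); ring. Qed.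
Lemma tau_lower t b : tau (lower5 t b) = lower2 t (tau b).
Proof. by rewrite /tau /lower5 /lower2 /=; congr (_, _, _); ring. Qed.
Lemma canonizant_upper t b : canonizant (upper5 t b) = upper3 t (canonizant b).
Proof. by rewrite /canonizant /upper5 /upper3 /=; congr (_, _, _, _); ring. Qed.
Lemma canonizant_lower t b : canonizant (lower5 t b) = lower3 t (canonizant b).
Proof. by rewrite /canonizant /lower5 /lower3 /=; congr (_, _, _, _); ring. Qed.
Lemma hessian_upper t c : hessian3 (upper3 t c) = upper2 t (hessian3 c).
Proof. by case: c => [[[c0 c1] c2] c3] /=; congr (_, _, _); ring. Qed.
Lemma hessian_lower t c : hessian3 (lower3 t c) = lower2 t (hessian3 c).
Proof. by case: c => [[[c0 c1] c2] c3] /=; congr (_, _, _); ring. Qed.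
Lemma disc_upper t p : disc2 (upper2 t p) = disc2 p.
Proof. by case: p => [[p0 p1] p2] /=; ring. Qed.
Lemma disc_lower t p : disc2 (lower2 t p) = disc2 p.
Proof. by case: p => [[p0 p1] p2] /=; ring. Qed.
Lemma polar_upper t p q : polar2 (upper2 t p) (upper2 t q) = polar2 p q.
Proof. by case: p => [[p0 p1] p2]; case: q => [[q0 q1] q2] /=; ring. Qed.
Lemma polar_lower t p q : polar2 (lower2 t p) (lower2 t q) = polar2 p q.
Proof. by case: p => [[p0 p1] p2]; case: q => [[q0 q1] q2] /=; ring. Qed.

Definition unipotent_invariant (I : seq T -> T) :=
  forall t b, I (upper5 t b) = I b /\ I (lower5 t b) = I b.

(** The identities are checked covariant by covariant, each polynomial identity
    being of low degree; a direct expansion of the invariant of degree 12 in the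
    coefficients of the quintic would be far larger. *)
Lemma I4_invariant : unipotent_invariant I4.
Proof. by move=> t b; rewrite /I4 tau_upper tau_lower disc_upper disc_lower. Qed.
Lemma I8_invariant : unipotent_invariant I8.
Proof.
move=> t b; rewrite /I8 tau_upper tau_lower canonizant_upper canonizant_lower.
by rewrite hessian_upper hessian_lower polar_upper polar_lower.
Qed.
Lemma I12_invariant : unipotent_invariant I12.
Proof.
move=> t b; rewrite /I12 canonizant_upper canonizant_lower.
by rewrite hessian_upper hessian_lower disc_upper disc_lower.
Qed.

(** The normalized coordinates of the sum of three fifth powers
    a x^5 + b y^5 + c z^5 with x + y + z = 0. *)
Definition sylvester (a b c : T) : seq T :=
  [:: a - c; - c; - c; - c; - c; b - c].

Lemma I4_sylvester a b c : I4 (sylvester a b c) =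
  (a * b + a * c + b * c) ^+ 2 - 4 * (a + b + c) * (a * b * c).
Proof. by rewrite /I4 /tau /sylvester /=; ring. Qed.

Lemma canonizant_sylvester a b c :
  canonizant (sylvester a b c) = (0, - (a * b * c), - (a * b * c), 0).
Proof. by rewrite /canonizant /sylvester /=; congr (_, _, _, _); ring. Qed.

Lemma I8_sylvester a b c : I8 (sylvester a b c) =
  - ((a * b * c) ^+ 2 * (a * b + a * c + b * c)).
Proof. by rewrite /I8 canonizant_sylvester /tau /sylvester /=; ring. Qed.

Lemma I12_sylvester a b c : I12 (sylvester a b c) = - (3 * (a * b * c) ^+ 4).
Proof. by rewrite /I12 canonizant_sylvester /=; ring. Qed.

End InvariantFormulas.

(** * Binary quintics and the action of SL(2) *)

Section Quintics.
Variable K : numClosedFieldType.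
Local Notation X := ('X_ord0 : {mpoly K[2]}).
Local Notation Y := ('X_ord_max : {mpoly K[2]}).

(** From normalized coefficients to the coordinates used by [form_coord]. *)
Definition pt (b : seq K) : 'I_6 -> K := fun i => b`_i *+ 'C(5, i).

Definition qform (b : seq K) : {mpoly K[2]} :=
  \sum_(i < 6) (pt b i)%:MP * (X ^+ (5 - i) * Y ^+ i).

Definition coeffs (v : 'I_6 -> K) : seq K :=
  mkseq (fun i => 'C(5, i)%:R^-1 * v (inord i)) 6.

Lemma bin5_neq0 (i : 'I_6) : 'C(5, i)%:R != 0 :> K.
Proof. by rewrite pnatr_eq0 -lt0n bin_gt0 -ltnS. Qed.

Lemma pt_coeffs v : pt (coeffs v) =1 v.
Proof.
move=> i; rewrite /pt nth_mkseq // inord_val -[LHS]mulr_natl mulrA divff ?mul1r //.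
exact: bin5_neq0.
Qed.

Lemma coeffs_pt b : size b = 6%N -> coeffs (pt b) = b.
Proof.
move=> sb; apply: (@eq_from_nth _ 0); rewrite size_mkseq ?sb // => i lti.
rewrite nth_mkseq // /pt inordK // -[b`_i *+ _]mulr_natl mulrA mulVf ?mul1r //.
exact: (bin5_neq0 (Ordinal lti)).
Qed.

Lemma monE (i : 'I_6) :
  X ^+ (5 - i) * Y ^+ i = 'X_[(U_(ord0) *+ (5 - i) + U_(ord_max) *+ i)%MM].
Proof. by rewrite mpolyXD !mpolyXn. Qed.

Lemma binary_mon0 a b : (U_(ord0 : 'I_2) *+ a + U_(ord_max) *+ b)%MM ord0 = a.
Proof. by rewrite mnmDE !mulmnE !mnm1E mul1n mul0n addn0. Qed.

Lemma binary_mon1 a b : (U_(ord0 : 'I_2) *+ a + U_(ord_max) *+ b)%MM ord_max = b.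
Proof. by rewrite mnmDE !mulmnE !mnm1E mul1n mul0n add0n. Qed.

Lemma linform_homog (u v : K) : u *: X + v *: Y \is 1.-homog.
Proof. by rewrite rpredD // rpredZ // dhomogX /= mdeg1. Qed.

Lemma X_homog : X \is 1.-homog. Proof. by rewrite dhomogX /= mdeg1. Qed.
Lemma Y_homog : Y \is 1.-homog. Proof. by rewrite dhomogX /= mdeg1. Qed.

Lemma binary_homog (b : seq K) (x y : {mpoly K[2]}) :
  x \is 1.-homog -> y \is 1.-homog ->
  \sum_(i < 6) (pt b i)%:MP * (x ^+ (5 - i) * y ^+ i) \is 5.-homog.
Proof.
move=> hx hy; apply: rpred_sum => i _; rewrite mul_mpolyC; apply: rpredZ.
have := dhomogM (dhomogMn (5 - i) hx) (dhomogMn i hy).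
by rewrite !mul1n subnK // -ltnS.
Qed.

Lemma qform_homog b : qform b \is 5.-homog.
Proof. by apply: binary_homog; [exact: X_homog | exact: Y_homog]. Qed.

Lemma form_coord_qform b : form_coord (d := 5) (qform b) =1 pt b.
Proof.
move=> i; rewrite /form_coord raddf_sum (bigD1 i) //= big1 ?addr0.
  by rewrite mcoeffCM monE mcoeffX eqxx mulr1.
move=> j ne; rewrite mcoeffCM monE mcoeffX; case: eqP => [/mnmP /(_ ord_max)|].
  rewrite !binary_mon1 => /val_inj ij.
  by rewrite ij eqxx in ne.
by rewrite mulr0.
Qed.

(** A monomial of degree 5 in two variables is determined by its exponent in the
    second one. *)
Lemma qform_coord (f : {mpoly K[2]}) : f \is 5.-homog ->
  f = qform (coeffs (form_coord (d := 5) f)).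
Proof.
move=> hf; apply/mpolyP => m; have [m5|m5] := eqVneq (mdeg m) 5%N; last first.
  by rewrite (dhomog_nemf_coeff hf m5) (dhomog_nemf_coeff (qform_homog _) m5).
have lt1 : (m ord_max < 6)%N.
  by rewrite ltnS -m5 mdegE big_ord_recr /= leq_addl.
have -> : m = (U_(ord0) *+ (5 - Ordinal lt1) + U_(ord_max) *+ Ordinal lt1)%MM.
  have m0 : (5 - m ord_max)%N = m ord0.
    by rewrite -m5 mdegE big_ord_recr big_ord1 /= addnK; congr (m _); apply: val_inj.
  apply/mnmP => i; have [->|->] : i = ord0 \/ i = ord_max.
    by case: i => [[|[|//]] lti]; [left | right]; apply: val_inj.
    by rewrite binary_mon0 /= m0.
  by rewrite binary_mon1.
have := form_coord_qform (coeffs (form_coord (d := 5) f)) (Ordinal lt1).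
by rewrite pt_coeffs /form_coord.
Qed.

Definition mx2 (p q r s : K) : 'M[K]_2 :=
  \matrix_(i, j) (if i == 0 then (if j == 0 then p else q)
                  else (if j == 0 then r else s)).

Lemma mx2E (g : 'M[K]_2) : g = mx2 (g 0 0) (g 0 1) (g 1 0) (g 1 1).
Proof.
apply/matrixP => i j; rewrite !mxE.
by case: i => [[|[|//]] ?]; case: j => [[|[|//]] ?] //=; congr (g _ _); apply: val_inj.
Qed.

Lemma det_mx2 p q r s : \det (mx2 p q r s) = p * s - q * r.
Proof.
rewrite (expand_det_row _ 0) big_ord_recl big_ord1 /cofactor !det_mx11 !mxE /=.
by rewrite expr0 expr1 mul1r mulN1r mulrN.
Qed.

Lemma mul_mx2 p q r s p' q' r' s' : mx2 p q r s *m mx2 p' q' r' s' =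
  mx2 (p * p' + q * r') (p * q' + q * s') (r * p' + s * r') (r * q' + s * s').
Proof.
apply/matrixP => i j; rewrite !mxE big_ord_recl big_ord1 !mxE.
by case: i => [[|[|//]] ?]; case: j => [[|[|//]] ?].
Qed.

Lemma form_act_qform p q r s b : form_act (mx2 p q r s) (qform b) =
  \sum_(i < 6) (pt b i)%:MP *
    ((p *: X + q *: Y) ^+ (5 - i) * (r *: X + s *: Y) ^+ i).
Proof.
rewrite /form_act /qform raddf_sum /=; apply: eq_bigr => i _.
rewrite !rmorphM !rmorphXn /= comp_mpolyC !comp_mpolyXU -!tnth_nth !tnth_mktuple.
rewrite !big_ord_recl !big_ord0 !mxE !addr0 /=.
by have -> : lift ord0 ord0 = ord_max :> 'I_2 by apply: val_inj.
Qed.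

Lemma form_act_homog (g : 'M[K]_2) (f : {mpoly K[2]}) : f \is 5.-homog -> form_act g f \is 5.-homog.
Proof.
move=> /qform_coord ->; rewrite [g]mx2E form_act_qform.
by apply: binary_homog; apply: linform_homog.
Qed.

Lemma form_actM (g h : 'M[K]_2) (f : {mpoly K[2]}) :
  form_act g (form_act h f) = form_act (h *m g) f.
Proof.
rewrite /form_act [f \mPo _]comp_mpolyEX [RHS]comp_mpolyEX raddf_sum /=.
apply: eq_bigr => m _; rewrite comp_mpolyZ !comp_mpolyX rmorph_prod /=.
congr (_ *: _); apply: eq_bigr => i _; rewrite rmorphXn /= !tnth_mktuple.
congr (_ ^+ _); rewrite raddf_sum /=.
under [RHS]eq_bigr do rewrite mxE scaler_suml.
rewrite [RHS]exchange_big /=; apply: eq_bigr => j _.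
rewrite comp_mpolyZ comp_mpolyXU -tnth_nth tnth_mktuple scaler_sumr.
by apply: eq_bigr => l _; rewrite scalerA.
Qed.

Lemma quintic_sumE b (x y : {mpoly K[2]}) :
  \sum_(i < 6) (pt b i)%:MP * (x ^+ (5 - i) * y ^+ i) =
  (b`_0)%:MP * x ^+ 5 + 5 * (b`_1)%:MP * (x ^+ 4 * y)
  + 10 * (b`_2)%:MP * (x ^+ 3 * y ^+ 2) + 10 * (b`_3)%:MP * (x ^+ 2 * y ^+ 3)
  + 5 * (b`_4)%:MP * (x * y ^+ 4) + (b`_5)%:MP * y ^+ 5.
Proof.
pose F i := ('C(5, i)%:R * b`_i)%:MP * (x ^+ (5 - i) * y ^+ i).
rewrite (eq_bigr (fun i : 'I_6 => F i)) => [|i _]; last by rewrite /F mulr_natl.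
rewrite -(big_mkord predT F) unlock /= /F !mpolyCM.
have -> : 'C(5, 0) = 1%N by []. have -> : 'C(5, 1) = 5%N by [].
have -> : 'C(5, 2) = 10%N by []. have -> : 'C(5, 3) = 10%N by [].
have -> : 'C(5, 4) = 5%N by []. have -> : 'C(5, 5) = 1%N by [].
rewrite /subn /=. ring.
Qed.

Lemma form_act_upper t b :
  form_act (mx2 1 t 0 1) (qform b) = qform (upper5 t b).
Proof.
rewrite form_act_qform /qform !quintic_sumE /upper5 /= -!mul_mpolyC !mpolyC1 mpolyC0.
ring.
Qed.

Lemma form_act_lower t b :
  form_act (mx2 1 0 t 1) (qform b) = qform (lower5 t b).
Proof.
rewrite form_act_qform /qform !quintic_sumE /lower5 /= -!mul_mpolyC !mpolyC1 mpolyC0.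
ring.
Qed.

Definition diag5 (u w : K) (b : seq K) : seq K :=
  [:: u ^+ 5 * b`_0; u ^+ 4 * w * b`_1; u ^+ 3 * w ^+ 2 * b`_2;
      u ^+ 2 * w ^+ 3 * b`_3; u * w ^+ 4 * b`_4; w ^+ 5 * b`_5].

Lemma form_act_diag u w b :
  form_act (mx2 u 0 0 w) (qform b) = qform (diag5 u w b).
Proof.
rewrite form_act_qform /qform !quintic_sumE /diag5 /= -!mul_mpolyC mpolyC0.
ring.
Qed.

(** The transpositions of x, y, z are linear substitutions of determinant -1, so
    that multiplied by a scalar e with e ^+ 2 = -1 they have determinant 1. *)
Lemma form_act_swap_xy e a b c : form_act (mx2 0 e e 0) (qform (sylvester a b c))
  = qform (map ( *%R (e ^+ 5)) (sylvester b a c)).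
Proof.
rewrite form_act_qform /qform !quintic_sumE /sylvester /= -!mul_mpolyC mpolyC0.
ring.
Qed.

Lemma form_act_swap_xz e a b c :
  form_act (mx2 (- e) (- e) 0 e) (qform (sylvester a b c))
  = qform (map ( *%R (e ^+ 5)) (sylvester c b a)).
Proof.
rewrite form_act_qform /qform !quintic_sumE /sylvester /= -!mul_mpolyC mpolyC0.
ring.
Qed.

Local Notation A := (@sl2_invariants K 5).

Lemma invariant_pt F g b c : A F -> \det g = 1 ->
  form_act g (qform b) = qform c -> F.@[pt c] = F.@[pt b].
Proof.
move=> AF g1 e; have := AF g _ g1 (qform_homog b).
by rewrite e !(meval_eq _ (form_coord_qform _)).
Qed.

Lemma meval_homog d n (F : {mpoly K[n]}) (v : 'I_n -> K) c :
  F \is d.-homog -> F.@[fun i => c * v i] = c ^+ d * F.@[v].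
Proof.
move=> /dhomogP hF; rewrite !mevalE mulr_sumr big_seq [RHS]big_seq.
apply: eq_bigr => m /hF md; rewrite mulrCA; congr (_ * _).
have -> : d = (\sum_i m i)%N by rewrite -mdegE -md.
by rewrite -prodrXr -big_split; apply: eq_bigr => i _; rewrite exprMn.
Qed.

Lemma meval_scaled d F b c : F \is d.-homog ->
  F.@[pt (map ( *%R c) b)] = c ^+ d * F.@[pt b].
Proof.
move=> hF; rewrite -(meval_homog _ _ hF); apply: meval_eq => i.
rewrite /pt mulrnAr; congr (_ *+ _); have [lti|gei] := ltnP i (size b).
  by rewrite (nth_map 0).
by rewrite !nth_default ?size_map // mulr0.
Qed.

(** A matrix whose lower left entry r is nonzero is a product upper, lower, upper of
    unipotent matrices; when r = 0 adding the first row to the second makes it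
    nonzero. *)
Lemma sl2_generation (G : 'M[K]_2 -> Prop) :
  (forall t, G (mx2 1 t 0 1)) -> (forall t, G (mx2 1 0 t 1)) ->
  (forall g h, G g -> G h -> G (g *m h)) -> forall g, \det g = 1 -> G g.
Proof.
move=> GU GL GM g; rewrite [g]mx2E det_mx2; move: (g 0 0) (g 0 1) (g 1 0) (g 1 1).
have big p q r s : r != 0 -> p * s - q * r = 1 -> G (mx2 p q r s).
  move=> r0 d1.
  have -> : mx2 p q r s =
      mx2 1 ((p - 1) / r) 0 1 *m mx2 1 0 r 1 *m mx2 1 ((s - 1) / r) 0 1.
    have -> : q = (p * s - 1) / r by rewrite -d1; field.
    by rewrite !mul_mx2; congr mx2; field.
  by apply: (GM _ _ (GM _ _ _ _)).
move=> p q r s d1; have [r0|r0] := eqVneq r 0; last exact: big.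
have -> : mx2 p q r s = mx2 1 0 (-1) 1 *m mx2 p q (p + r) (q + s).
  by rewrite !mul_mx2; congr mx2; ring.
apply: GM => //; apply: big; last by rewrite -d1; ring.
apply/eqP => pr; have := d1; rewrite r0 mulr0 subr0 -[p]addr0 -r0 pr mul0r.
by move/eqP; rewrite eq_sym oner_eq0.
Qed.

Lemma invariant_unipotent F :
  (forall t b, size b = 6%N ->
     F.@[pt (upper5 t b)] = F.@[pt b] /\ F.@[pt (lower5 t b)] = F.@[pt b]) ->
  A F.
Proof.
move=> FU g f g1; move: g g1 f.
have sz f : size (coeffs (form_coord (d := 5) f)) = 6%N by rewrite size_mkseq.
apply: sl2_generation.
- move=> t f hf; rewrite {1}(qform_coord hf) form_act_upper.
  rewrite (meval_eq _ (form_coord_qform _)) (FU _ _ (sz f)).1.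
  exact/meval_eq/pt_coeffs.
- move=> t f hf; rewrite {1}(qform_coord hf) form_act_lower.
  rewrite (meval_eq _ (form_coord_qform _)) (FU _ _ (sz f)).2.
  exact/meval_eq/pt_coeffs.
- move=> g h Gg Gh f hf; rewrite -form_actM Gh ?Gg //.
  exact: form_act_homog.
Qed.

(** For the homogeneous components: the values of an invariant F at c v and at
    c (g v) agree for all scalars c, and the coefficients of these polynomials in c
    are the values of the components of F. *)
Lemma sl2_invariants_graded : graded_subalgebra A.
Proof.
split.
- by move=> c g f _ _; rewrite !mevalC.
- by move=> F G AF AG g f g1 hf; rewrite !mevalD AF ?AG.
- by move=> F G AF AG g f g1 hf; rewrite !mevalM AF ?AG.
move=> F d AF g f g1 hf.
pose p v : {poly K} := \poly_(e < msize F) (pihomog mdeg e F).@[v].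
have pE v c : (p v).[c] = F.@[fun i => c * v i].
  rewrite horner_poly [in RHS](pihomog_partitionE (leqnn (msize F))) raddf_sum.
  by apply: eq_bigr => e _; rewrite /= (meval_homog _ _ (pihomogP _ _ _)) mulrC.
suff /polyP /(_ d) : p (form_coord (form_act g f)) = p (form_coord f).
  rewrite !coef_poly; case: ltnP => // led _.
  suff -> : pihomog mdeg d F = 0 by rewrite !meval0.
  rewrite pihomogE big_seq_cond big_pred0 // => m; apply/negP => /andP [mF /eqP md].
  by have := msize_mdeg_lt mF; rewrite md ltnNge led.
apply/eqP; rewrite -subr_eq0; apply/eqP/poly_eq0_char0 => c.
rewrite hornerD hornerN !pE.
have scale (h : {mpoly K[2]}) : form_coord (d := 5) (c *: h) =1 (fun i => c * form_coord h i).
  by move=> i; rewrite /form_coord mcoeffZ.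
rewrite -!(meval_eq _ (scale _)) -[c *: form_act g f]comp_mpolyZ.
by rewrite (AF g (c *: f)) ?subrr // rpredZ.
Qed.

End Quintics.

(** * The basic invariants and Sylvester's canonical form *)

Section BasicInvariants.
Variable K : numClosedFieldType.
Local Notation A := (@sl2_invariants K 5).

Section Morphism.
Variables (T T' : comNzRingType) (f : {rmorphism T -> T'}) (b : seq T).

Lemma nth_map0 i : (map f b)`_i = f b`_i.
Proof.
have [lti|gei] := ltnP i (size b); first by rewrite (nth_map 0).
by rewrite !nth_default ?size_map // rmorph0.
Qed.

Lemma tau_map : tau (map f b) =
  (f (tau b).1.1, f (tau b).1.2, f (tau b).2).
Proof. by rewrite /tau !nth_map0 /=; congr (_, _, _); ring. Qed.

Lemma hessian_canonizant_map : hessian3 (canonizant (map f b)) =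
  let h := hessian3 (canonizant b) in (f h.1.1, f h.1.2, f h.2).
Proof.
have -> : canonizant (map f b) = let: (c0, c1, c2, c3) := canonizant b in
    (f c0, f c1, f c2, f c3).
  by rewrite /canonizant !nth_map0; congr (_, _, _, _); ring.
case: (canonizant b) => [[[c0 c1] c2] c3] /=.
by congr (_, _, _); ring.
Qed.

Lemma I4_map : I4 (map f b) = f (I4 b).
Proof. by rewrite /I4 tau_map; case: (tau b) => [[p0 p1] p2] /=; ring. Qed.
Lemma I8_map : I8 (map f b) = f (I8 b).
Proof.
rewrite /I8 tau_map hessian_canonizant_map; case: (tau b) => [[p0 p1] p2] /=.
by case: (hessian3 (canonizant b)) => [[q0 q1] q2] /=; ring.
Qed.
Lemma I12_map : I12 (map f b) = f (I12 b).
Proof.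
rewrite /I12 hessian_canonizant_map.
by case: (hessian3 (canonizant b)) => [[q0 q1] q2] /=; ring.
Qed.

End Morphism.

Definition generic : seq {mpoly K[6]} :=
  mkseq (fun i => 'C(5, i)%:R^-1 *: 'X_(inord i)) 6.

(** J12 is normalized so as to be e3^4 on Sylvester's canonical forms. *)
Definition J4 := I4 generic.
Definition J8 := I8 generic.
Definition J12 := (-3)^-1 *: I12 generic.

Lemma meval_generic v : map (meval v) generic = coeffs v.
Proof.
rewrite /generic /coeffs /mkseq -map_comp; apply: eq_map => i /=.
by rewrite mevalZ mevalXU.
Qed.

Lemma meval_J4 v : J4.@[v] = I4 (coeffs v).
Proof. by rewrite -meval_generic I4_map. Qed.
Lemma meval_J8 v : J8.@[v] = I8 (coeffs v).
Proof. by rewrite -meval_generic I8_map. Qed.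
Lemma meval_J12 v : J12.@[v] = (-3)^-1 * I12 (coeffs v).
Proof. by rewrite -meval_generic I12_map mevalZ. Qed.

Lemma generic_homog i : generic`_i \is 1.-homog.
Proof.
have [lti|gei] := ltnP i 6; last by rewrite nth_default ?size_mkseq ?dhomog0.
by rewrite nth_mkseq //; apply: rpredZ; rewrite dhomogX /= mdeg1.
Qed.

Lemma homogM n d e c (p q : {mpoly K[n]}) : p \is d.-homog -> q \is e.-homog ->
  c = (d + e)%N -> p * q \is c.-homog.
Proof. by move=> hp hq ->; apply: dhomogM. Qed.

Lemma homog_natM n d m (p : {mpoly K[n]}) :
  p \is d.-homog -> m%:R * p \is d.-homog.
Proof. by move=> hp; rewrite mulr_natl; apply: rpredMn. Qed.

Lemma homogD n d (p q : {mpoly K[n]}) :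
  p \is d.-homog -> q \is d.-homog -> p + q \is d.-homog.
Proof. exact: rpredD. Qed.

Lemma homogB n d (p q : {mpoly K[n]}) :
  p \is d.-homog -> q \is d.-homog -> p - q \is d.-homog.
Proof. exact: rpredB. Qed.

Definition hom3 n d (p : {mpoly K[n]} * {mpoly K[n]} * {mpoly K[n]}) : Prop :=
  [/\ p.1.1 \is d.-homog, p.1.2 \is d.-homog & p.2 \is d.-homog].

Lemma disc2_homog n d (p : {mpoly K[n]} * {mpoly K[n]} * {mpoly K[n]}) :
  hom3 d p -> disc2 p \is (d + d).-homog.
Proof.
case: p => [[p0 p1] p2] [/= h0 h1 h2]; rewrite -mulrA expr2.
by apply: rpredB; [|apply: homog_natM]; apply: dhomogM.
Qed.

Lemma polar2_homog n d e (p q : {mpoly K[n]} * {mpoly K[n]} * {mpoly K[n]}) :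
  hom3 d p -> hom3 e q -> polar2 p q \is (d + e).-homog.
Proof.
case: p => [[p0 p1] p2] [/= h0 h1 h2]; case: q => [[q0 q1] q2] [/= k0 k1 k2].
by rewrite -!mulrA; apply: rpredD; [apply: rpredB; [apply: homog_natM|]|apply: homog_natM];
  apply: dhomogM.
Qed.

Section HomogeneousCovariants.
Variable b : seq {mpoly K[6]}.
Hypothesis hb : forall i, b`_i \is 1.-homog.

Lemma coef_mul_homog i j : b`_i * b`_j \is 2.-homog.
Proof. exact: homogM (hb i) (hb j) _. Qed.

Lemma coef_minor_homog i j k l m :
  b`_i * (b`_j * b`_k - b`_l * b`_m) \is 3.-homog.
Proof. by apply: homogM (hb i) (homogB (coef_mul_homog _ _) (coef_mul_homog _ _)) _. Qed.

Lemma tau_homog : hom3 2 (tau b).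
Proof.
have h := coef_mul_homog; rewrite /tau !expr2 -!mulrA; split => /=.
- exact: homogD (homogB (h _ _) (homog_natM _ (h _ _))) (homog_natM _ (h _ _)).
- exact: homogD (homogB (h _ _) (homog_natM _ (h _ _))) (homog_natM _ (h _ _)).
- exact: homogD (homogB (h _ _) (homog_natM _ (h _ _))) (homog_natM _ (h _ _)).
Qed.

Lemma hessian_homog : hom3 6 (hessian3 (canonizant b)).
Proof.
have hc : let: (c0, c1, c2, c3) := canonizant b in
   [/\ c0 \is 3.-homog, c1 \is 3.-homog, c2 \is 3.-homog & c3 \is 3.-homog].
  have h := coef_minor_homog; rewrite /canonizant !expr2.
  by split; exact: homogD (homogB (h _ _ _ _ _) (h _ _ _ _ _)) (h _ _ _ _ _).
case: (canonizant b) hc => [[[c0 c1] c2] c3] [h0 h1 h2 h3].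
have hM (p q : {mpoly K[6]}) : p \is 3.-homog -> q \is 3.-homog -> p * q \is 6.-homog.
  by move=> hp hq; apply: homogM hp hq _.
by split; rewrite /= ?expr2 -!mulrA; apply: homogB; rewrite ?homog_natM ?hM.
Qed.

End HomogeneousCovariants.

Lemma J4_homog : J4 \is 4.-homog.
Proof. exact: disc2_homog (tau_homog generic_homog). Qed.
Lemma J8_homog : J8 \is 8.-homog.
Proof. exact: polar2_homog (tau_homog generic_homog) (hessian_homog generic_homog). Qed.
Lemma J12_homog : J12 \is 12.-homog.
Proof. by apply: rpredZ; exact: disc2_homog (hessian_homog generic_homog). Qed.

Lemma J4_invariant : A J4.
Proof.
apply: invariant_unipotent => t b sb; rewrite !meval_J4 !coeffs_pt //.
exact: I4_invariant.
Qed.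
Lemma J8_invariant : A J8.
Proof.
apply: invariant_unipotent => t b sb; rewrite !meval_J8 !coeffs_pt //.
exact: I8_invariant.
Qed.
Lemma J12_invariant : A J12.
Proof.
apply: invariant_unipotent => t b sb; rewrite !meval_J12 !coeffs_pt //.
by case: (I12_invariant t b) => -> ->.
Qed.

Definition sl2_equiv (b c : seq K) : Prop :=
  exists2 g : 'M[K]_2, \det g = 1 & form_act g (qform b) = qform c.

Lemma sl2_equiv_trans b c d : sl2_equiv b c -> sl2_equiv c d -> sl2_equiv b d.
Proof.
move=> [g g1 gb] [h h1 hc]; exists (g *m h); first by rewrite det_mulmx g1 h1 mulr1.
by rewrite -form_actM gb hc.
Qed.

Lemma sl2_equiv_upper t b : sl2_equiv b (upper5 t b).
Proof.
by exists (mx2 1 t 0 1); [rewrite det_mx2; ring | apply: form_act_upper].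
Qed.

Lemma sl2_equiv_lower t b : sl2_equiv b (lower5 t b).
Proof.
by exists (mx2 1 0 t 1); [rewrite det_mx2; ring | apply: form_act_lower].
Qed.

(** The alternative is that the polynomial is constant. *)
Lemma cubic_root (c0 c1 c2 c3 : K) :
  (exists t, c0 + t * c1 + t ^+ 2 * c2 + t ^+ 3 * c3 = 0) \/
  [/\ c1 = 0, c2 = 0 & c3 = 0].
Proof.
pose p := Poly [:: c0; c1; c2; c3].
have [|sp] := boolP (size p != 1%N).
  case/closed_rootP => t /rootP; rewrite horner_Poly /= => pt0; left; exists t.
  by rewrite -[RHS]pt0; ring.
right; have pc i : (0 < i)%N -> p`_i = 0.
  by move=> i0; apply: nth_default; rewrite (eqP (negbNE sp)).
by have := (pc 1 isT, pc 2 isT, pc 3 isT); rewrite !coef_Poly /= => -[[]].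
Qed.

(** Cramer's rule: the maximal minors with signs span the kernel of the Hankel matrix. *)
Lemma canonizant_kernel b i : (i < 3)%N ->
  let: (c0, c1, c2, c3) := canonizant b in
  b`_i * c3 - b`_i.+1 * c2 + b`_i.+2 * c1 - b`_i.+3 * c0 = 0 :> K.
Proof. by case: i => [|[|[|//]]] _ /=; ring. Qed.

(** An upper and a lower unipotent substitution move one root of the canonizant to
    each coordinate axis, so that it becomes x y (c1 x + c2 y), with c1 and c2
    nonzero because I12 is. Its coefficients (0, c1, c2, 0) satisfy the kernel
    relations, which say that b_1, ..., b_4 is a geometric progression of ratio
    c2 / c1; a diagonal substitution makes these four coefficients equal. *)
Lemma sylvester_form b : I12 b != 0 ->
  exists x y z, sl2_equiv b (sylvester x y z).
Proof.
move=> n0.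
have [b1 [eb1 n1 w3]] : exists b1, [/\ sl2_equiv b b1, I12 b1 != 0
    & (canonizant b1).2 = 0].
  case E: (canonizant b) => [[[c0 c1] c2] c3].
  have [[t rt]|[z2 z1 z0]] := cubic_root c3 c2 c1 c0.
    exists (upper5 t b); rewrite canonizant_upper E (I12_invariant t b).1.
    by split=> //; exact: sl2_equiv_upper.
  by case/eqP: n0; rewrite /I12 E z0 z1 z2 /=; ring.
have [b2 [eb2 n2 d3 d0]] : exists b2, [/\ sl2_equiv b1 b2, I12 b2 != 0,
    (canonizant b2).2 = 0 & (canonizant b2).1.1.1 = 0].
  case E: (canonizant b1) w3 => [[[c0 c1] c2] c3] z3; rewrite /= in z3.
  have [[t rt]|[z1 z2 _]] := cubic_root c0 c1 c2 c3.
    exists (lower5 t b1); rewrite canonizant_lower E (I12_invariant t b1).2.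
    by split=> //; exact: sl2_equiv_lower.
  by case/eqP: n1; rewrite /I12 E z1 z2 z3 /=; ring.
have ker := canonizant_kernel b2; rewrite /I12 in n2; clear w3.
case: (canonizant b2) ker n2 d3 d0 => [[[c0 c1] c2] c3] /= ker n2 z3 z0.
rewrite {}z0 {}z3 in ker n2.
have c1n : c1 != 0 by apply: contra_neq n2 => ->; ring.
have c2n : c2 != 0 by apply: contra_neq n2 => ->; ring.
pose r := c2 / c1; pose u := sqrtC r.
have ur : u ^+ 2 = r by apply: sqrtCK.
have u0 : u != 0 by rewrite sqrtC_eq0 mulf_neq0 ?invr_eq0.
have rel i : (i < 3)%N -> b2`_i.+2 = u ^+ 2 * b2`_i.+1.
  move=> /ker /eqP; rewrite !mulr0 add0r subr0 addrC subr_eq0 => /eqP e.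
  by rewrite ur /r mulrAC [c2 * _]mulrC -e mulfK.
pose x := b2`_1 * u ^+ 3.
exists (u ^+ 5 * b2`_0 - x), (u^-1 ^+ 5 * b2`_5 - x), (- x).
apply: (sl2_equiv_trans eb1 (sl2_equiv_trans eb2 _)).
exists (mx2 u 0 0 u^-1); first by rewrite det_mx2; field.
rewrite form_act_diag; congr qform; rewrite /diag5 /sylvester /x.
rewrite (rel 2%N) // (rel 1%N) // (rel 0%N) //.
by congr [:: _; _; _; _; _; _]; field.
Qed.

Lemma sl2_equiv_meval F b c : A F -> sl2_equiv b c -> F.@[pt c] = F.@[pt b].
Proof. by move=> AF [g g1 e]; apply: invariant_pt e. Qed.

Lemma meval_J12_sylvester x y z :
  J12.@[pt (sylvester x y z)] = (x * y * z) ^+ 4.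
Proof. by rewrite meval_J12 coeffs_pt // I12_sylvester; field. Qed.

Lemma J12_neq0 : J12 != 0.
Proof.
apply/eqP => e; have := meval_J12_sylvester 1 1 1.
by rewrite e meval0 !mulr1 expr1n => /eqP; rewrite eq_sym oner_eq0.
Qed.

(** The product F * J12 vanishes at every quintic: either J12 does, or the quintic is
    equivalent to a Sylvester form, at which F vanishes. *)
Lemma invariant_eq0 F : A F ->
  (forall x y z, F.@[pt (sylvester x y z)] = 0) -> F = 0.
Proof.
move=> AF F0; apply/eqP; rewrite -[_ == _]orbF -(negbTE J12_neq0) -mulf_eq0.
apply/eqP/mpoly_eq0_char0 => v; rewrite mevalM meval_J12.
have [->|n0] := eqVneq (I12 (coeffs v)) 0; first by rewrite !mulr0.
have [x [y [z e]]] := sylvester_form n0.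
rewrite -(meval_eq _ (pt_coeffs v)) -(sl2_equiv_meval AF e) F0 mul0r //.
Qed.

End BasicInvariants.

(** * Generation and independence of the basic invariants *)

Section FractionFieldInvolution.
Variable K : numClosedFieldType.
Local Notation A := (@sl2_invariants K 5).
Local Notation J4 := (J4 K).
Local Notation J8 := (J8 K).
Local Notation J12 := (J12 K).

Lemma big_ord3 (T : Type) (idx : T) (op : Monoid.law idx) (F : 'I_3 -> T) :
  \big[op/idx]_(i < 3) F i = op (op (F (inord 0)) (F (inord 1))) (F (inord 2)).
Proof.
rewrite !big_ord_recr big_ord0 /= Monoid.mul1m.
by congr (op (op (F _) (F _)) (F _)); apply: val_inj; rewrite /= inordK.
Qed.

(** Restriction to the Sylvester forms, as a polynomial in the coefficients of the
    three fifth powers. *)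
Definition restrict (F : {mpoly K[6]}) : {mpoly K[3]} :=
  F \mPo [tuple (sylvester 'X_(inord 0) 'X_(inord 1) 'X_(inord 2))`_i *+ 'C(5, i) | i < 6].

Lemma meval_restrict F (x : 'I_3 -> K) :
  (restrict F).@[x] =
  F.@[pt (sylvester (x (inord 0)) (x (inord 1)) (x (inord 2)))].
Proof.
rewrite comp_mpoly_meval; apply: meval_eq => i; rewrite tnth_mktuple mevalMn /pt.
rewrite -nth_map0; congr (_ *+ _); congr nth.
by rewrite /sylvester /= !mevalB !mevalN !mevalXU.
Qed.

(** The scalar by which a transposition has to be corrected is a fourth root of unity,
    which disappears in degrees divisible by 4. *)
Lemma swap_invariant F n : A F -> F \is (12 * n).-homog ->
  forall x y z,
    F.@[pt (sylvester y x z)] = F.@[pt (sylvester x y z)] /\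
    F.@[pt (sylvester z y x)] = F.@[pt (sylvester x y z)].
Proof.
move=> AF hF x y z; pose e : K := 'i.
have e2 : e * e = -1 by rewrite -expr2 sqrCi.
have e60 : (e ^+ 5) ^+ (12 * n) = 1.
  rewrite -exprM mulnA (_ : (5 * 12 = 2 * (2 * 15))%N) // !exprM [e ^+ 2]expr2 e2.
  by rewrite sqrrN !expr1n.
split; rewrite -[LHS]mul1r -e60 -(meval_scaled _ _ hF).
  apply: (invariant_pt AF _ (form_act_swap_xy e x y z)).
  by rewrite det_mx2 mul0r e2 sub0r opprK.
apply: (invariant_pt AF _ (form_act_swap_xz e x y z)).
by rewrite det_mx2 mulr0 subr0 mulNr e2 opprK.
Qed.

Lemma meval_msym n (s : 'S_n) (p : {mpoly K[n]}) (x : 'I_n -> K) :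
  (msym s p).@[x] = p.@[x \o s].
Proof.
elim/mpolyind: p => [|c m p _ _ IH]; first by rewrite msym0 !meval0.
rewrite msymD msymZ msymX !mevalD !mevalZ IH; congr (_ * _ + _).
rewrite !mevalX.
rewrite (reindex_inj (@perm_inj _ s)) /=; apply: eq_bigr => i _.
by rewrite mnmE permK.
Qed.

Lemma restrict_symmetric F n : A F -> F \is (12 * n).-homog ->
  restrict F \is symmetric.
Proof.
move=> AF hF; have sw := swap_invariant AF hF.
apply/issymP => s; apply/eqP; rewrite -subr_eq0; apply/eqP/mpoly_eq0_char0 => x.
rewrite mevalB; apply/eqP; rewrite subr_eq0; apply/eqP.
rewrite meval_msym.
rewrite !meval_restrict /=.
have [] : [/\ s (inord 0) != s (inord 1), s (inord 0) != s (inord 2)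
            & s (inord 1) != s (inord 2)].
  by split; rewrite (inj_eq perm_inj) -val_eqE /= !inordK.
have i3 (i : 'I_3) : [\/ i = inord 0, i = inord 1 | i = inord 2].
  by case: i => [[|[|[|//]]] lti]; [constructor 1|constructor 2|constructor 3];
     apply: val_inj; rewrite /= inordK.
case: (i3 (s (inord 0))) => ->; case: (i3 (s (inord 1))) => ->;
  case: (i3 (s (inord 2))) => ->; rewrite ?eqxx // => _ _ _;
  set a := x _; set b := x _; set c := x _.
all: have P1 u v w := (sw u v w).1; have P2 u v w := (sw u v w).2.
all: first [by rewrite P1 | by rewrite P2 | by rewrite P1 P2 | by rewrite P2 P1
  | by rewrite P1 P2 P1].
Qed.

(** The sign e is kept as a parameter: the substitutions for e = 1 and e = -1 are the
    inclusion of the algebra of basic invariants and its composite with the sign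
    change of J8. *)
Definition gens (e : K) : 3.-tuple {mpoly K[6]} := [tuple J4; e *: J8; J12].

Local Notation theta e := (comp_mpoly (gens e)).

Lemma gens_invariant e i : A (tnth (gens e) i).
Proof.
have gA := sl2_invariants_graded K.
case: i => [[|[|[|//]]] lti]; rewrite (tnth_nth 0) /=.
- exact: J4_invariant.
- by rewrite -mul_mpolyC; apply: (gsa_mul gA); [apply: (gsa_const gA) | apply: J8_invariant].
- exact: J12_invariant.
Qed.

Lemma theta_invariant e p : A (theta e p).
Proof.
have gA := sl2_invariants_graded K.
rewrite comp_mpolyE; apply: (gsa_sum gA) => m _.
rewrite -mul_mpolyC; apply: (gsa_mul gA); first exact: (gsa_const gA).
elim/big_rec: _ => [|i q _ Aq]; first by rewrite -mpolyC1; apply: (gsa_const gA).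
by apply: (gsa_mul gA) => //; apply: (gsa_exp gA); apply: gens_invariant.
Qed.

Local Notation x0 := ('X_(inord 0) : {mpoly K[3]}).
Local Notation x1 := ('X_(inord 1) : {mpoly K[3]}).
Local Notation x2 := ('X_(inord 2) : {mpoly K[3]}).

Lemma theta_x0 e : theta e x0 = J4.
Proof. by rewrite comp_mpolyXU inordK. Qed.
Lemma theta_x1 e : theta e x1 = e *: J8.
Proof. by rewrite comp_mpolyXU inordK. Qed.
Lemma theta_x2 e : theta e x2 = J12.
Proof. by rewrite comp_mpolyXU inordK. Qed.

Definition e1 (x : 'I_3 -> K) := x (inord 0) + x (inord 1) + x (inord 2).
Definition e2 (x : 'I_3 -> K) :=
  x (inord 0) * x (inord 1) + x (inord 0) * x (inord 2) + x (inord 1) * x (inord 2).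
Definition e3 (x : 'I_3 -> K) := x (inord 0) * x (inord 1) * x (inord 2).

Lemma meval_mesym (x : 'I_3 -> K) (i : 'I_3) :
  (mesym 3 K i.+1).@[x] = nth 0 [:: e1 x; e2 x; e3 x] i.
Proof.
case: i => [[|[|[|//]]] lti] /=.
- by rewrite mesym1E raddf_sum /= big_ord3 !mevalXU.
- rewrite mesymSS mesymnnE mesym1E rmorph_prod raddf_sum /= !big_ord_recr !big_ord0 /=.
  rewrite !mwidenX !mnmwiden1 /= mul1r add0r mevalD !mevalM mevalD !mevalXU /e2.
  rewrite mulrDl addrA.
  by congr (x _ * x _ + x _ * x _ + x _ * x _); apply: val_inj; rewrite /= inordK.
- by rewrite mesymnnE rmorph_prod /= big_ord3 !mevalXU.
Qed.

Definition syl (x : 'I_3 -> K) := sylvester (x (inord 0)) (x (inord 1)) (x (inord 2)).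

Lemma J4_syl x : J4.@[pt (syl x)] = e2 x ^+ 2 - 4 * e1 x * e3 x.
Proof. by rewrite meval_J4 coeffs_pt // I4_sylvester. Qed.
Lemma J8_syl x : J8.@[pt (syl x)] = - (e3 x ^+ 2 * e2 x).
Proof. by rewrite meval_J8 coeffs_pt // I8_sylvester. Qed.
Lemma J12_syl x : J12.@[pt (syl x)] = e3 x ^+ 4.
Proof. exact: meval_J12_sylvester. Qed.

(** The expression for e1 e3^5 in terms of J4, J8 and J12. *)
Definition recover_e1 : {mpoly K[3]} := 4^-1 *: (x1 ^+ 2 - x0 * x2).

Lemma recover_e1_syl x :
  (theta 1 recover_e1).@[pt (syl x)] = e1 x * e3 x ^+ 5.
Proof.
rewrite /recover_e1 comp_mpolyZ rmorphB rmorphXn rmorphM /=.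
rewrite theta_x0 theta_x1 theta_x2 scale1r mevalZ mevalB !mevalM.
by rewrite J4_syl J8_syl J12_syl; field.
Qed.

Lemma recover_e1_homog e : theta e recover_e1 \is 16.-homog.
Proof.
rewrite /recover_e1 comp_mpolyZ rmorphB rmorphXn rmorphM /=.
rewrite theta_x0 theta_x1 theta_x2; apply/rpredZ/homogB.
  exact: dhomogMn 2 (rpredZ e (J8_homog K)).
exact: homogM (J4_homog K) (J12_homog K) (erefl _).
Qed.

Lemma monomial_collect (a b c : K) p q k :
  (a * c ^+ 5) ^+ p * (c ^+ 2 * b) ^+ q * c ^+ 4 ^+ k
  = a ^+ p * b ^+ q * c ^+ (5 * p + 2 * q + 4 * k).
Proof.
rewrite (exprMn p a) (exprMn q (c ^+ 2)) -!exprM !exprD.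
by move: (a ^+ p) (b ^+ q) (c ^+ (5 * p)) (c ^+ (2 * q)) (c ^+ (4 * k)) => *; ring.
Qed.

Lemma comp_homog n k d (F : {mpoly K[n]}) (l : n.-tuple {mpoly K[k]}) :
  F \is d.-homog -> (forall i, tnth l i \is 1.-homog) -> F \mPo l \is d.-homog.
Proof.
move=> hF hl; rewrite comp_mpolyE big_seq; apply: rpred_sum => m mF.
apply: rpredZ; rewrite -(dhomogP _ _ _ hF m mF) /= mdegE.
elim/big_rec2: _ => [|i p e _ hp]; first exact: dhomog1.
by apply: homogM (dhomogMn _ (hl i)) hp _; rewrite mul1n.
Qed.

(** Write the restriction of F as a sum of monomials e1^p e2^q e3^r with
    p + 2 q + 3 r = 12 n. Since e1 e3^5 and e3^2 e2 are expressed by basic invariants,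
    there remains a power of e3, of exponent r + 60 n - 5 p - 2 q
    = 4 (r + 12 n - p) once F is multiplied by J12^(15 n), hence a power of J12.
    Homogeneity is needed for every e, as J8 will change sign. *)
Lemma generation F n : A F -> F \is (12 * n).-homog ->
  exists Q N, theta 1 Q = F * J12 ^+ N /\
    forall e, theta e Q \is (12 * (n + N)).-homog.
Proof.
move=> AF hF; have gA := sl2_invariants_graded K.
have sF := restrict_symmetric AF hF.
have hrF : restrict F \is (12 * n).-homog.
  apply: comp_homog hF _ => i; rewrite tnth_mktuple -mulr_natl; apply: homog_natM.
  have h j : ('X_j : {mpoly K[3]}) \is 1.-homog by rewrite dhomogX /= mdeg1.
  rewrite /sylvester; case: i => [[|[|[|[|[|[|//]]]]]] lti] /=;
    first [exact: homogB (h _) (h _) | by rewrite rpredN; apply: h].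
have [t [tF ht]] := sym_fundamental_homog sF hrF.
pose mon (m : 'X_{1..3}) := recover_e1 ^+ m (inord 0) * (- x1) ^+ m (inord 1) *
   x2 ^+ (m (inord 2) + 12 * n - m (inord 0)).
pose Q := \sum_(m <- msupp t) t@_m *: mon m.
have wt m : m \in msupp t ->
    (m (inord 0) + 2 * m (inord 1) + 3 * m (inord 2) = 12 * n)%N.
  move=> mt; rewrite -(dhomogP _ _ _ ht m mt) /= /mnmwgt big_ord3 !inordK //.
  by rewrite muln1 [(_ * 2)%N]mulnC [(_ * 3)%N]mulnC.
(* The exponent 15 n makes r + 12 n - p nonnegative, as p <= 12 n. *)
exists Q, (15 * n)%N; split.
  apply/eqP; rewrite -subr_eq0; apply/eqP/invariant_eq0.
    apply: (gsa_add gA); first exact: theta_invariant.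
    rewrite -mulN1r -mpolyC1 -mpolyCN; apply: (gsa_mul gA); first exact: (gsa_const gA).
    by apply: (gsa_mul gA) => //; apply: (gsa_exp gA); apply: J12_invariant.
  move=> a b c; pose x : 'I_3 -> K := tnth [tuple a; b; c].
  have -> : sylvester a b c = syl x by rewrite /syl /x !(tnth_nth 0) /= !inordK.
  apply/eqP; rewrite mevalB subr_eq0; apply/eqP.
  rewrite mevalM rmorphXn /= J12_syl -(meval_restrict F) -tF.
  rewrite [t \mPo _]comp_mpolyE /Q (raddf_sum (comp_mpoly (gens 1))).
  rewrite !(raddf_sum (meval _)) /= mulr_suml.
    apply: eq_big_seq => m mt.
  rewrite comp_mpolyZ !mevalZ -mulrA; congr (_ * _).
  rewrite /mon !rmorphM !rmorphXn /= rmorphN /= theta_x1 theta_x2 scale1r.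
  rewrite recover_e1_syl ?rmorphN /= J8_syl J12_syl.
  rewrite rmorph_prod /= big_ord3 !rmorphXn /= !tnth_mktuple !meval_mesym !inordK //=.
  have wm := wt m mt; rewrite opprK monomial_collect -exprM.
  set p := m (inord 0) in wm *; set q := m (inord 1) in wm *.
  set r := m (inord 2) in wm *.
  have E : (5 * p + 2 * q + 4 * (r + 12 * n - p) = r + 4 * (15 * n))%N by lia.
  by rewrite -[RHS]mulrA -exprD -E.
move=> e; rewrite /Q (raddf_sum (comp_mpoly (gens e))) /= big_seq; apply: rpred_sum => m /wt wm.
rewrite comp_mpolyZ; apply: rpredZ.
rewrite /mon !rmorphM !rmorphXn /= rmorphN /= theta_x1 theta_x2.
apply: homogM (homogM (dhomogMn _ (recover_e1_homog e))
  (dhomogMn _ (_ : _ \is 8.-homog)) (erefl _)) (dhomogMn _ (J12_homog K)) _.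
  by rewrite rpredN; apply: rpredZ; apply: J8_homog.
by lia.
Qed.

(** The values of e3, e2, e1 are found in this order, e3 being a fourth root of w. Then c
    is a root of the cubic with these elementary symmetric functions and the two
    other roots satisfy a quadratic. *)
Lemma invariants_surjective (u v w : K) : w != 0 ->
  exists x, [/\ J4.@[pt (syl x)] = u, J8.@[pt (syl x)] = v & J12.@[pt (syl x)] = w].
Proof.
move=> w0; pose c3 : K := 4.-root w; have c34 : c3 ^+ 4 = w by apply: rootCK.
have c30 : c3 != 0 by apply: contra_neq w0 => c0; rewrite -c34 c0 expr0n.
pose c2 := - v / c3 ^+ 2; pose c1 := (c2 ^+ 2 - u) / (4 * c3).
have [[t rt]|[_ _ /eqP]] := cubic_root (- c3) c2 (- c1) 1; last by rewrite oner_eq0.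
have [[s rs]|[_ /eqP]] := cubic_root (c2 - t * (c1 - t)) (t - c1) 1 0; last first.
  by rewrite oner_eq0.
exists (tnth [tuple s; c1 - t - s; t]).
have E1 : e1 (tnth [tuple s; c1 - t - s; t]) = c1.
  by rewrite /e1 !(tnth_nth 0) !inordK //=; ring.
have E2 : e2 (tnth [tuple s; c1 - t - s; t]) = c2.
  rewrite /e2 !(tnth_nth 0) !inordK //=; apply/eqP; rewrite -subr_eq0 -oppr_eq0 -rs.
  by apply/eqP; ring.
have E3 : e3 (tnth [tuple s; c1 - t - s; t]) = c3.
  rewrite /e3 !(tnth_nth 0) !inordK //=; apply/eqP; rewrite -subr_eq0.
  apply/eqP; transitivity ((- c3 + t * c2 + t ^+ 2 * - c1 + t ^+ 3 * 1)
    - t * (c2 - t * (c1 - t) + s * (t - c1) + s ^+ 2 * 1 + s ^+ 3 * 0)); first ring.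
  by rewrite rt rs mulr0 subr0.
rewrite J4_syl J8_syl J12_syl E1 E2 E3; split => //; rewrite /c1 /c2; field => //.
Qed.

Lemma x2_neq0 : x2 != 0.
Proof.
apply/eqP => /(congr1 (meval (fun=> 1))); rewrite mevalXU meval0 => /eqP.
by rewrite oner_eq0.
Qed.

(** A relation p among the generators vanishes wherever the last variable is nonzero,
    by surjectivity, so p times that variable vanishes everywhere. *)
Lemma theta_inj e p : e != 0 -> theta e p = 0 -> p = 0.
Proof.
move=> e0 pt0; apply/eqP; rewrite -[_ == _]orbF.
rewrite -(negbTE x2_neq0) -mulf_eq0; apply/eqP/mpoly_eq0_char0 => v.
rewrite mevalM mevalXU; have [->|w0] := eqVneq (v (inord 2)) 0; first by rewrite mulr0.
have [x [h4 h8 h12]] := invariants_surjective (v (inord 0)) (e^-1 * v (inord 1)) w0.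
suff -> : p.@[v] = (theta e p).@[pt (syl x)] by rewrite pt0 meval0 mul0r.
rewrite comp_mpoly_meval; apply: meval_eq => i; rewrite (tnth_nth 0).
case: i => [[|[|[|//]]] lti] /=.
- by rewrite h4; congr v; apply: val_inj; rewrite /= inordK.
- by rewrite mevalZ h8 mulVKf //; congr v; apply: val_inj; rewrite /= inordK.
- by rewrite h12; congr v; apply: val_inj; rewrite /= inordK.
Qed.

(** * The involution *)

Definition flip : {mpoly K[3]} -> {mpoly K[3]} :=
  comp_mpoly [tuple x0; - x1; x2].

Lemma theta_flip e p : theta e (flip p) = theta (- e) p.
Proof.
rewrite /flip [p \mPo _]comp_mpolyE (raddf_sum (comp_mpoly (gens e))) /= comp_mpolyE.
apply: eq_bigr => m _; rewrite comp_mpolyZ rmorph_prod /=; congr (_ *: _).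
apply: eq_bigr => i _; rewrite rmorphXn; congr (_ ^+ _).
rewrite !(tnth_nth 0); case: i => [[|[|[|//]]] lti] /=.
- exact: theta_x0.
- by rewrite rmorphN /= theta_x1 scaleNr.
- exact: theta_x2.
Qed.

Local Notation "a %:F" := (tofrac a) (at level 1, format "a %:F").
Local Notation frac := {fraction {mpoly K[6]}}.

Definition theta_fraction (x : frac) : Prop :=
  exists p, p.2 != 0 /\ x = (theta 1 p.1)%:F / (theta 1 p.2)%:F.

(** The sign change of J8 on the fractions in the basic invariants. A numerator and a
    denominator are chosen; by [theta_inj] the choice is irrelevant. Elsewhere the
    value 0 is arbitrary. *)
Definition psi (x : frac) : frac :=
  if pselect (theta_fraction x) is left h
  then let p := projT1 (cid h) in (theta (-1) p.1)%:F / (theta (-1) p.2)%:F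
  else 0.

Lemma theta_frac_neq0 e p : e != 0 -> p != 0 -> (theta e p)%:F != 0.
Proof.
move=> e0; rewrite tofrac_eq0; apply: contra_neq; exact: theta_inj.
Qed.

Let N10 : (-1 : K) != 0. Proof. by rewrite oppr_eq0 oner_eq0. Qed.

Lemma psiE p q : q != 0 ->
  psi ((theta 1 p)%:F / (theta 1 q)%:F) = (theta (-1) p)%:F / (theta (-1) q)%:F.
Proof.
move=> q0; rewrite /psi; case: pselect => [h|[]]; last by exists (p, q).
have n1 r := @theta_frac_neq0 1 r (oner_neq0 _).
have n2 r := @theta_frac_neq0 (-1) r N10.
case: (cid h) => -[p' q'] /= [q'0 /eqP].
rewrite (eqr_div _ _ (n1 q q0) (n1 q' q'0)) -!tofracM tofrac_eq -!rmorphM /=.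
rewrite -subr_eq0 -rmorphB => /eqP /(theta_inj (oner_neq0 _)) /eqP.
rewrite subr_eq0 => /eqP e; apply/eqP.
rewrite (eqr_div _ _ (n2 q' q'0) (n2 q q0)) -!tofracM tofrac_eq -!rmorphM /=.
by rewrite e.
Qed.

Lemma theta1 e : theta e 1 = 1.
Proof. exact: rmorph1. Qed.

Lemma theta_x2X e N : theta e (x2 ^+ N) = J12 ^+ N.
Proof. by rewrite rmorphXn /= theta_x2. Qed.

(** A fraction a / b equals a b^11 / b^12, whose numerator and denominator have degree
    divisible by 12, so that [generation] applies to both. *)
Lemma frac0_theta x : frac0 A x -> theta_fraction x.
Proof.
move=> [d [a [b [ha hb b0 ->]]]]; have gA := sl2_invariants_graded K.
have [hA hh] := piece_mul gA ha (piece_exp gA 11 hb).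
have [hB hk] := piece_exp gA 12 hb.
rewrite -mulnS mulnC in hh; rewrite mulnC in hk.
have [P [M [eP _]]] := generation hA hh; have [Q [N [eQ _]]] := generation hB hk.
have J0 k : (J12 ^+ k)%:F != 0 by rewrite tofrac_eq0 expf_neq0 ?J12_neq0.
have bk k : (b ^+ k)%:F != 0 by rewrite tofrac_eq0 expf_neq0.
exists (P * x2 ^+ N, Q * x2 ^+ M); split => /=.
  rewrite mulf_neq0 ?expf_neq0 ?x2_neq0 //; apply/eqP => Q0.
  have := J0 N; have := bk 12%N; move: eQ; rewrite Q0 rmorph0 => /esym/eqP.
  by rewrite mulf_eq0 !tofrac_eq0 => /orP [] ->.
rewrite [theta 1 (P * _)]rmorphM [theta 1 (Q * _)]rmorphM /= !theta_x2X eP eQ.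
have nb : b%:F != 0 by rewrite tofrac_eq0.
have nd : (b ^+ 12 * J12 ^+ N * J12 ^+ M)%:F != 0.
  rewrite tofrac_eq0; apply: mulf_neq0; last exact: expf_neq0 (J12_neq0 K).
  by apply: mulf_neq0; apply: expf_neq0 => //; exact: J12_neq0.
apply/eqP; rewrite (eqr_div _ _ nb nd) -!tofracM tofrac_eq; apply/eqP.
by move: (J12 ^+ M) (J12 ^+ N) => u v; rewrite (exprS b 11); ring.
Qed.

Lemma psi_loc_theta x : loc A 12 J12 x -> loc A 12 J12 (psi x).
Proof.
move=> [m [a [[Aa ha] ->]]]; have [Q [N [eQ hQ]]] := generation Aa ha.
have J0 : J12%:F != 0 by rewrite tofrac_eq0 J12_neq0.
have -> : a%:F / J12%:F ^+ m = (theta 1 Q)%:F / (theta 1 (x2 ^+ (m + N)))%:F.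
  rewrite eQ theta_x2X tofracM !tofracXn exprD.
  by rewrite -mulf_div (divff (expf_neq0 N J0)) mulr1.
rewrite psiE ?expf_neq0 ?x2_neq0 //; exists (m + N)%N, (theta (-1) Q).
by split; [split; [apply: theta_invariant|]|rewrite theta_x2X tofracXn].
Qed.

Lemma psi_add x y : frac0 A x -> frac0 A y -> psi (x + y) = psi x + psi y.
Proof.
move=> /frac0_theta [[p q] /= [q0 ->]] /frac0_theta [[p' q'] /= [q'0 ->]].
rewrite addf_div ?theta_frac_neq0 ?oner_eq0 // -!tofracM -tofracD -!rmorphM -rmorphD.
rewrite !psiE ?mulf_neq0 // addf_div ?theta_frac_neq0 //.
by rewrite -!tofracM -tofracD -!rmorphM -rmorphD.
Qed.

Lemma psi_mul x y : frac0 A x -> frac0 A y -> psi (x * y) = psi x * psi y.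
Proof.
move=> /frac0_theta [[p q] /= [q0 ->]] /frac0_theta [[p' q'] /= [q'0 ->]].
by rewrite mulf_div -!tofracM -!rmorphM !psiE ?mulf_neq0 // mulf_div -!tofracM -!rmorphM.
Qed.

Lemma psi_const c : psi (c%:MP)%:F = (c%:MP)%:F.
Proof.
have := psiE c%:MP (oner_neq0 _).
by rewrite !theta1 !comp_mpolyC tofrac1 !divr1.
Qed.

Lemma psi_involutive x : frac0 A x -> psi (psi x) = x.
Proof.
move=> /frac0_theta [[p q] /= [q0 ->]]; rewrite psiE // -!theta_flip psiE.
  by rewrite !theta_flip opprK.
by apply: contra_neq q0 => f0; apply: (theta_inj N10); rewrite -theta_flip f0 rmorph0.
Qed.

(** J8 occurs to an odd power. *)
Lemma psi_witness : psi ((J8 ^+ 3)%:F / (J12 ^+ 2)%:F) = - ((J8 ^+ 3)%:F / (J12 ^+ 2)%:F).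
Proof.
have -> : J8 ^+ 3 = theta 1 (x1 ^+ 3) by rewrite rmorphXn /= theta_x1 scale1r.
rewrite -(theta_x2X 1) psiE ?expf_neq0 ?x2_neq0 //.
rewrite !theta_x2X !rmorphXn /= !theta_x1 scale1r scaleN1r.
by rewrite rmorphN /= -mulNr; congr (_ / _); rewrite !exprS expr0; ring.
Qed.

Lemma J8_neq0 : J8 != 0.
Proof.
apply/eqP => e; have := J8_syl (tnth [tuple 1; 1; 1]).
rewrite e meval0 /e3 /e2 !(tnth_nth 0) !inordK //= => h.
have /eqP : 3%:R = 0 :> K by rewrite -oppr0 h; ring.
by rewrite pnatr_eq0.
Qed.

(** A rational map equal to the identity would act trivially on the stalks at some
    point with J12 <> 0, whereas J8^3 / J12^2 belongs to them and changes sign. *)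
Theorem nontrivial_birational_self_map :
  exists U f, birational_map A U f /\ ~ rational_eq A U f (proj A) (idm K 6).
Proof.
have gA := sl2_invariants_graded K.
have hs : graded_piece A 12 J12 by split; [apply: J12_invariant | apply: J12_homog].
have h8 : graded_piece A 8 J8 by split; [apply: J8_invariant | apply: J8_homog].
have s0 := J12_neq0 K.
exists (basic_open A J12), (involution_mor A 12 J12 psi); split.
  apply: involution_birational => //.
  - exact: psi_add.
  - exact: psi_mul.
  - exact: psi_const.
  - exact: psi_loc_theta.
  - exact: psi_involutive.
move=> [W [oW dW subW eqW]].
have [p0 gen] := generic_point gA (isT : (0 < 12)%N) hs s0.
have oU := basic_open_open hs.
have [P [WP [pP nPs]]] : (W `&` basic_open A J12) !=set0.
  by apply: dW => //; exists [set 0]; split=> //; apply/eqP.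
have [fP eqx] := eqW P WP.
pose x := (J8 ^+ 3)%:F / (J12 ^+ 2)%:F.
have h24 : graded_piece A 24 (J8 ^+ 3) := piece_exp gA 3 h8.
have k24 : graded_piece A 24 (J12 ^+ 2) := piece_exp gA 2 hs.
have : stalk A P x.
  exists 24%N, (J8 ^+ 3), (J12 ^+ 2); split => //.
  by apply: (notinX gA pP) => //; case: hs.
have -> : stalk A P = stalk A (involution_mor A 12 J12 psi P) by rewrite fP.
move=> /eqx /=; rewrite /x psi_witness -mulNr -tofracN => /eqP.
have t0 : (J12 ^+ 2)%:F != 0 by rewrite tofrac_eq0 expf_neq0.
rewrite (inj_eq (mulIf (invr_neq0 t0))) tofrac_eq eq_sym -addr_eq0.
rewrite -mulr2n -scaler_nat scaler_eq0 pnatr_eq0 /=.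
by rewrite expf_eq0 (negbTE J8_neq0).
Qed.

End FractionFieldInvolution.

Theorem theorem3 (R : realType) :
  exists (U : set (set {mpoly (complex R)[6]}))
         (f : premorphism (complex R) 6),
    birational_map (quintic_invariants R) U f /\
    ~ rational_eq (quintic_invariants R) U f
        (proj (quintic_invariants R)) (idm (complex R) 6).
Proof. exact: nontrivial_birational_self_map. Qed.
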